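(* Let $F$ be a number field, $M$ an snt-module over $F$ with a decomposition $M=M_-\oplus M_+$ into $F[[t]]$-stable Lagrangian subspaces, $V$ a finite-dimensional $F$-vector space with a non-degenerate symmetric bilinear form $(\,,\,)$, and $G$ the orthogonal group of $V$. Two elements $x,y\in M_-\otimes_FV$ are in the same $G(F[[t]])$-orbit if and only if $\mathrm{Im}\,f_x=\mathrm{Im}\,f_y$ and $T(x)=T(y)$.
   Context: An snt-module is a finite-dimensional $F$-vector space $M$ which is an $F[t]$-module on which some power of $t$ acts as $0$ (hence an $F[[t]]$-module), with a symplectic form such that $\langle t\xi,\eta\rangle=\langle\xi,t\eta\rangle$. Put $V[[t]]=V\otimes_FF[[t]]$, with $(\,,\,)$ extended $F[[t]]$-bilinearly to an $F[[t]]$-valued form. $M_-\otimes_FV=M_-\otimes_{F[[t]]}V[[t]]$, on which $G(F[[t]])$ acts (from the right) through the second factor: $(u\otimes v)\cdot g=u\otimes(v\cdot g)$. For $x=\sum_iu_i\otimes v_i\in M_-\otimes_{F[[t]]}V[[t]]$, the $F[[t]]$-linear map $f_x:V[[t]]\to M_-$ is $f_x(v)=\sum_i(v_i,v)u_i$, and $\mathrm{Im}\,f_x$ is its image, an $F[[t]]$-submodule of $M_-$. One has $x\in\mathrm{Im}\,f_x\otimes_{F[[t]]}V[[t]]$. Let $S_t^2(\mathrm{Im}\,f_x)$ be the submodule of symmetric tensors in $\mathrm{Im}\,f_x\otimes_{F[[t]]}\mathrm{Im}\,f_x$, and let $T:\mathrm{Im}\,f_x\otimes_{F[[t]]}V[[t]]\to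 S_t^2(\mathrm{Im}\,f_x)$ be the map $\sum_iu_i\otimes v_i\mapsto\sum_{i,j}(v_i,v_j)\,u_i\otimes u_j$. The equality $T(x)=T(y)$ is understood in $S_t^2(\mathrm{Im}\,f_x)=S_t^2(\mathrm{Im}\,f_y)$ (not in $S_t^2(M_-)$). *)

(* Defs.v *)
From HB Require Import structures.
From mathcomp Require Import all_boot all_order all_algebra all_field.
From mathcomp Require Import sesquilinear.
From mathcomp Require Import boolp.

Set Implicit Arguments.
Unset Strict Implicit.
Unset Printing Implicit Defensive.

Import GRing.Theory.
Local Open Scope ring_scope.
Local Open Scope quotient_scope.

Definition fps (K : comNzRingType) : Type := nat -> K.
Notation "{ 'fps' K }" := (fps K) (format "{ 'fps'  K }") : type_scope.

Section FPS.
Variable K : comNzRingType.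
Implicit Types a b c : {fps K}.

HB.instance Definition _ := Choice.copy {fps K} (nat -> K).

Definition fps0 : {fps K} := fun=> 0.
Definition fps_opp a : {fps K} := fun n => - a n.
Definition fps_add a b : {fps K} := fun n => a n + b n.
Definition fps_const (x : K) : {fps K} := fun n => x *+ (n == 0%N).
Definition fps_mul a b : {fps K} := fun n => \sum_(i < n.+1) a i * b (n - i)%N.
Definition fps_scale (x : K) a : {fps K} := fun n => x * a n.

Fact fps_addA : associative fps_add.
Proof. by move=> a b c; apply/funext=> n; apply: addrA. Qed.
Fact fps_addC : commutative fps_add.
Proof. by move=> a b; apply/funext=> n; apply: addrC. Qed.
Fact fps_add0 : left_id fps0 fps_add.
Proof. by move=> a; apply/funext=> n; apply: add0r. Qed.
Fact fps_addN : left_inverse fps0 fps_opp fps_add.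
Proof. by move=> a; apply/funext=> n; apply: addNr. Qed.

HB.instance Definition _ := GRing.isZmodule.Build {fps K}
  fps_addA fps_addC fps_add0 fps_addN.

Let trunc n a : {poly K} := \poly_(i < n) a i.

Let coef_trunc n a i : (i < n)%N -> (trunc n a)`_i = a i.
Proof. by move=> ltin; rewrite coef_poly ltin. Qed.

Let mul_trunc m n a b :
  (n < m)%N -> fps_mul a b n = (trunc m a * trunc m b)`_n.
Proof.
move=> ltnm; rewrite coefM; apply: eq_bigr => i _.
have lei : (i <= n)%N by rewrite -ltnS.
by rewrite !coef_trunc ?(leq_ltn_trans _ ltnm) ?leq_subr.
Qed.

Fact fps_mulC : commutative fps_mul.
Proof.
by move=> a b; apply/funext=> n; rewrite !(@mul_trunc n.+1) // mulrC.
Qed.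

Fact fps_mulA : associative fps_mul.
Proof.
move=> a b c; apply/funext=> n.
transitivity ((trunc n.+1 a * (trunc n.+1 b * trunc n.+1 c))`_n).
  rewrite coefM; apply: eq_bigr => i _.
  have lei : (i <= n)%N by rewrite -ltnS.
  by rewrite coef_trunc // (@mul_trunc n.+1) // ltnS leq_subr.
rewrite mulrA coefM; apply: eq_bigr => i _.
by rewrite coef_trunc ?ltnS ?leq_subr // (@mul_trunc n.+1).
Qed.

Fact fps_mul1 : left_id (fps_const 1) fps_mul.
Proof.
move=> a; apply/funext=> n; rewrite /fps_mul big_ord_recl /= mul1r subn0.
by rewrite big1 ?addr0 // => i _; rewrite /fps_const /= mul0r.
Qed.

Fact fps_mulDl : left_distributive fps_mul fps_add.
Proof.
move=> a b c; apply/funext=> n; rewrite /fps_mul /fps_add -big_split /=.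
by apply: eq_bigr => i _; rewrite mulrDl.
Qed.

Fact fps_one_neq0 : fps_const 1 != 0 :> {fps K}.
Proof. by apply/eqP=> /(congr1 (@^~ 0%N)) /eqP; rewrite oner_eq0. Qed.

HB.instance Definition _ := GRing.Zmodule_isComNzRing.Build {fps K}
  fps_mulA fps_mulC fps_mul1 fps_mulDl fps_one_neq0.

Fact fps_scaleA x y a : fps_scale x (fps_scale y a) = fps_scale (x * y) a.
Proof. by apply/funext=> n; apply: mulrA. Qed.
Fact fps_scale1 : left_id 1 fps_scale.
Proof. by move=> a; apply/funext=> n; apply: mul1r. Qed.
Fact fps_scaleDr : right_distributive fps_scale +%R.
Proof. by move=> x a b; apply/funext=> n; apply: mulrDr. Qed.
Fact fps_scaleDl a : {morph fps_scale^~ a : x y / x + y}.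
Proof. by move=> x y; apply/funext=> n; apply: mulrDl. Qed.

HB.instance Definition _ := GRing.Zmodule_isLmodule.Build K {fps K}
  fps_scaleA fps_scale1 fps_scaleDr fps_scaleDl.

Lemma fps_scalerAl (x : K) a b : (x *: a) * b = x *: (a * b).
Proof.
apply/funext=> n; rewrite [RHS]/GRing.scale /= /fps_scale mulr_sumr.
by apply: eq_bigr => i _; rewrite mulrA.
Qed.

Lemma fps_scalerAr (x : K) a b : a * (x *: b) = x *: (a * b).
Proof. by rewrite mulrC fps_scalerAl mulrC. Qed.

Lemma fps_const_mul x a : (fps_const x : {fps K}) * a = x *: a.
Proof.
rewrite (_ : fps_const x = x *: (1 : {fps K})) ?fps_scalerAl ?mul1r //.
by apply/funext=> n; rewrite [RHS]mulr_natr.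
Qed.

End FPS.

(* Elements of [M (x)_R N] are finite formal sums of pairs, modulo the least
   congruence making the pairing bilinear. *)
Inductive tensor_rel (R : comNzRingType) (M N : lmodType R) :
    seq (M * N) -> seq (M * N) -> Prop :=
  | TensorRefl s : tensor_rel s s
  | TensorSym s1 s2 : tensor_rel s1 s2 -> tensor_rel s2 s1
  | TensorTrans s1 s2 s3 :
      tensor_rel s1 s2 -> tensor_rel s2 s3 -> tensor_rel s1 s3
  | TensorCat s1 s2 r1 r2 :
      tensor_rel s1 r1 -> tensor_rel s2 r2 -> tensor_rel (s1 ++ s2) (r1 ++ r2)
  | TensorComm s1 s2 : tensor_rel (s1 ++ s2) (s2 ++ s1)
  | Tensor0l v : tensor_rel [:: (0, v)] [::]
  | TensorDl u1 u2 v : tensor_rel [:: (u1 + u2, v)] [:: (u1, v); (u2, v)]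
  | TensorDr u v1 v2 : tensor_rel [:: (u, v1 + v2)] [:: (u, v1); (u, v2)]
  | TensorZ a u v : tensor_rel [:: (a *: u, v)] [:: (u, a *: v)].

Section Tensor.
Variables (R : comNzRingType) (M N : lmodType R).

Definition tensor_eqb (s1 s2 : seq (M * N)) : bool := `[< tensor_rel s1 s2 >].

Fact tensor_eqb_refl : reflexive tensor_eqb.
Proof. by move=> s; apply/asboolP/TensorRefl. Qed.
Fact tensor_eqb_sym : symmetric tensor_eqb.
Proof. by move=> s1 s2; apply/asboolP/asboolP => /TensorSym. Qed.
Fact tensor_eqb_trans : transitive tensor_eqb.
Proof.
move=> s2 s1 s3 /asboolP s12 /asboolP s23; apply/asboolP.
exact: TensorTrans s23.
Qed.

Canonical tensor_equiv :=
  EquivRel tensor_eqb tensor_eqb_refl tensor_eqb_sym tensor_eqb_trans.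

Definition tensor : Type := {eq_quot tensor_equiv}.
HB.instance Definition _ := Choice.on tensor.
HB.instance Definition _ := EqQuotient.on tensor.
Implicit Types (x y z : tensor) (s : seq (M * N)).

Lemma tensor_piP s1 s2 : tensor_rel s1 s2 <-> \pi_tensor s1 = \pi_tensor s2.
Proof.
split=> [s12|/eqquotP/asboolP//].
by apply/eqquotP/asboolP.
Qed.

Lemma tensor_repr s : tensor_rel (repr (\pi_tensor s)) s.
Proof. by apply/tensor_piP; rewrite reprK. Qed.

Definition balanced (P : zmodType) (f : M -> N -> P) : Prop :=
  [/\ forall v, {morph f^~ v : u1 u2 / u1 + u2},
      forall u, {morph f u : v1 v2 / v1 + v2}
    & forall a u v, f (a *: u) v = f u (a *: v)].

Definition tlift (P : zmodType) (f : M -> N -> P) z : P :=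
  \sum_(p <- repr z) f p.1 p.2.

Lemma balanced_rel (P : zmodType) (f : M -> N -> P) s1 s2 :
  balanced f -> tensor_rel s1 s2 ->
  \sum_(p <- s1) f p.1 p.2 = \sum_(p <- s2) f p.1 p.2.
Proof.
move=> [fDl fDr fZ]; elim=> {s1 s2} //=.
- by move=> s1 s2 s3 _ -> _ ->.
- by move=> s1 s2 r1 r2 _ e1 _ e2; rewrite !big_cat e1 e2.
- by move=> s1 s2; rewrite !big_cat /= addrC.
- move=> v; rewrite big_seq1 big_nil /=.
  by apply/(addrI (f 0 v)); rewrite -fDl !addr0.
- by move=> u1 u2 v; rewrite !big_cons !big_nil !addr0 fDl.
- by move=> u v1 v2; rewrite !big_cons !big_nil !addr0 fDr.
- by move=> a u v; rewrite !big_seq1 fZ.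
Qed.

Lemma tlift_pi (P : zmodType) (f : M -> N -> P) s :
  balanced f -> tlift f (\pi_tensor s) = \sum_(p <- s) f p.1 p.2.
Proof. by move=> bf; apply: balanced_rel (tensor_repr s). Qed.

Definition tzero : tensor := \pi_tensor [::].
Definition tadd x y : tensor := \pi_tensor (repr x ++ repr y).
Definition topp x : tensor := \pi_tensor [seq (- p.1, p.2) | p <- repr x].
Definition tscale a x : tensor := \pi_tensor [seq (a *: p.1, p.2) | p <- repr x].

Let tadd_pi s1 s2 : tadd (\pi_tensor s1) (\pi_tensor s2) = \pi_tensor (s1 ++ s2).
Proof. by apply/tensor_piP; apply: TensorCat; apply: tensor_repr. Qed.

Fact tadd0 : left_id tzero tadd.
Proof. by move=> x; rewrite -[x]reprK tadd_pi. Qed.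
Fact taddC : commutative tadd.
Proof. by move=> x y; apply/tensor_piP/TensorComm. Qed.
Fact taddA : associative tadd.
Proof.
elim/quotW=> r; elim/quotW=> s; elim/quotW=> t.
by rewrite (tadd_pi s t) (tadd_pi r s) (tadd_pi r) (tadd_pi _ t) catA.
Qed.

Let map_rel (f : M -> M) s1 s2 :
    f 0 = 0 -> {morph f : u1 u2 / u1 + u2} -> (forall a, {morph f : u / a *: u}) ->
  tensor_rel s1 s2 ->
  tensor_rel [seq (f p.1, p.2) | p <- s1] [seq (f p.1, p.2) | p <- s2].
Proof.
move=> f0 fD fZ; elim=> {s1 s2} /=.
- by move=> s; apply: TensorRefl.
- by move=> s1 s2 _; apply: TensorSym.
- by move=> s1 s2 s3 _ h1 _; apply: TensorTrans.
- by move=> s1 s2 r1 r2 _ h1 _ h2; rewrite !map_cat; apply: TensorCat.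
- by move=> s1 s2; rewrite !map_cat; apply: TensorComm.
- by move=> v; rewrite f0; apply: Tensor0l.
- by move=> u1 u2 v; rewrite fD; apply: TensorDl.
- by move=> u v1 v2; apply: TensorDr.
- by move=> a u v; rewrite fZ; apply: TensorZ.
Qed.

Let topp_pi s : topp (\pi_tensor s) = \pi_tensor [seq (- p.1, p.2) | p <- s].
Proof.
apply/tensor_piP/map_rel/tensor_repr; [exact: oppr0 | exact: opprD|].
by move=> a u; rewrite scalerN.
Qed.

Let tscale_pi a s : tscale a (\pi_tensor s) = \pi_tensor [seq (a *: p.1, p.2) | p <- s].
Proof.
apply/tensor_piP/map_rel/tensor_repr; [exact: scaler0 | exact: scalerDr|].
by move=> b u; rewrite !scalerA mulrC.
Qed.

Fact taddN : left_inverse tzero topp tadd.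
Proof.
elim/quotW=> t; rewrite (topp_pi t) tadd_pi; apply/tensor_piP.
elim: t => [|[u v] s IHs] /=; first exact: TensorRefl.
rewrite -cat1s -[(u, v) :: s]cat1s.
apply: (@TensorTrans _ _ _ _ ([:: (- u, v)] ++ ([:: (u, v)] ++
    ([seq (- p.1, p.2) | p <- s] ++ s)))).
  apply: TensorCat; first exact: TensorRefl.
  rewrite !catA; apply: TensorCat; last exact: TensorRefl.
  exact: TensorComm.
rewrite catA -[[::]]cats0; apply: TensorCat => //.
apply: TensorTrans (Tensor0l _ v); apply: TensorSym.
by rewrite -(addNr u); apply: TensorDl.
Qed.

HB.instance Definition _ :=
  GRing.isZmodule.Build tensor taddA taddC tadd0 taddN.

Fact tscaleA a b x : tscale a (tscale b x) = tscale (a * b) x.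
Proof.
elim/quotW: x => s.
rewrite (tscale_pi b) (tscale_pi a) (tscale_pi (a * b)) -map_comp.
apply: congr1; apply: eq_map => -[u v] /=; by rewrite scalerA.
Qed.

Fact tscale1 : left_id 1 tscale.
Proof.
elim/quotW=> s; rewrite (tscale_pi 1) -[s in RHS]map_id.
apply: congr1; apply: eq_map => -[u v] /=; by rewrite scale1r.
Qed.

Fact tscaleDr : right_distributive tscale +%R.
Proof.
move=> a; elim/quotW=> s; elim/quotW=> t.
rewrite [X in tscale _ X](tadd_pi s t) !(tscale_pi a) map_cat.
by rewrite [RHS]tadd_pi.
Qed.

Fact tscaleDl x : {morph tscale^~ x : a b / a + b}.
Proof.
move=> a b; elim/quotW: x => t.
rewrite (tscale_pi a) (tscale_pi b) (tscale_pi (a + b)) [RHS]tadd_pi.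
apply/tensor_piP; elim: t => [|[u v] s IHs] /=; first exact: TensorRefl.
set A := map _ s in IHs *; set B := map _ s in IHs *; set C := map _ s in IHs *.
apply: (@TensorTrans _ _ _ _ ([:: (a *: u, v); (b *: u, v)] ++ (B ++ C))).
  rewrite -[X in tensor_rel X]cat1s; apply: TensorCat IHs.
  by rewrite scalerDl; apply: TensorDl.
apply: (@TensorCat _ _ _ [:: (a *: u, v)] _ [:: (a *: u, v)]).
  exact: TensorRefl.
rewrite -[X in tensor_rel X]cat1s -[X in tensor_rel _ (_ ++ X)]cat1s !catA.
by apply: TensorCat; [apply: TensorComm | apply: TensorRefl].
Qed.

HB.instance Definition _ := GRing.Zmodule_isLmodule.Build R tensor
  tscaleA tscale1 tscaleDr tscaleDl.

Definition tens (u : M) (v : N) : tensor := \pi_tensor [:: (u, v)].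

Lemma tensDl v : {morph tens^~ v : u1 u2 / u1 + u2}.
Proof. by move=> u1 u2; rewrite [RHS]tadd_pi; apply/tensor_piP/TensorDl. Qed.
Lemma tensDr u : {morph tens u : v1 v2 / v1 + v2}.
Proof. by move=> v1 v2; rewrite [RHS]tadd_pi; apply/tensor_piP/TensorDr. Qed.
Lemma tensZl a u v : tens (a *: u) v = a *: tens u v.
Proof. by rewrite [RHS]tscale_pi. Qed.
Lemma tensZr a u v : tens u (a *: v) = a *: tens u v.
Proof. by rewrite -tensZl; apply/esym/tensor_piP/TensorZ. Qed.

Lemma tens0l v : tens 0 v = 0.
Proof. by rewrite -(scale0r 0) tensZl scale0r. Qed.
Lemma tens0r u : tens u 0 = 0.
Proof. by rewrite -(scale0r 0) tensZr scale0r. Qed.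

Lemma tensor_piE s : \pi_tensor s = \sum_(p <- s) tens p.1 p.2.
Proof.
elim: s => [|[u v] s IHs]; first by rewrite big_nil.
by rewrite big_cons -IHs [RHS]tadd_pi.
Qed.

Lemma tensor_sum z : z = \sum_(p <- repr z) tens p.1 p.2.
Proof. by rewrite -tensor_piE reprK. Qed.

Lemma tensor_ind (Q : tensor -> Prop) :
    Q 0 -> (forall u v, Q (tens u v)) ->
    (forall x y, Q x -> Q y -> Q (x + y)) ->
  forall z, Q z.
Proof. by move=> Q0 Qt QD z; rewrite (tensor_sum z); apply: big_ind. Qed.

Section Lift.
Variables (P : zmodType) (f : M -> N -> P).
Hypothesis bf : balanced f.

Lemma tlift_tens u v : tlift f (tens u v) = f u v.
Proof. by rewrite tlift_pi // big_seq1. Qed.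

Lemma tliftD : {morph tlift f : x y / x + y}.
Proof.
elim/quotW=> s; elim/quotW=> t; rewrite [X in tlift f X](tadd_pi s t).
by rewrite !tlift_pi // big_cat.
Qed.

Lemma tlift0 : tlift f 0 = 0.
Proof. by rewrite tlift_pi // big_nil. Qed.

Lemma tlift_sum I (r : seq I) (Q : pred I) (E : I -> tensor) :
  tlift f (\sum_(i <- r | Q i) E i) = \sum_(i <- r | Q i) tlift f (E i).
Proof. exact: (big_morph _ tliftD tlift0). Qed.

End Lift.

Lemma tliftZ (P : lmodType R) (f : M -> N -> P) :
  balanced f -> (forall a u v, f (a *: u) v = a *: f u v) ->
  forall a z, tlift f (a *: z) = a *: tlift f z.
Proof.
move=> bf fZ a; elim/quotW=> s.
rewrite [X in tlift f X](tscale_pi a s) !tlift_pi //.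
by rewrite big_map scaler_sumr; apply: eq_bigr => p _; rewrite fZ.
Qed.

End Tensor.

Notation "u *t v" := (tens u v) (at level 40, left associativity) : ring_scope.

Definition tmap (R : comNzRingType) (M N M' N' : lmodType R)
    (f : M -> M') (g : N -> N') : tensor M N -> tensor M' N' :=
  tlift (fun u v => f u *t g v).

Section TensorMaps.
Variables (R : comNzRingType) (M N M' N' : lmodType R).

Fact tens_balanced : balanced (@tens R M N).
Proof.
by split=> [v|u|a u v]; [apply: tensDl | apply: tensDr | rewrite tensZl tensZr].
Qed.

Fact tmap_balanced (f : {linear M -> M'}) (g : {linear N -> N'}) :
  balanced (fun u v => f u *t g v).
Proof.
split=> [v u1 u2|u v1 v2|a u v]; first by rewrite linearD tensDl.
  by rewrite linearD tensDr.
by rewrite !linearZ /= tensZl tensZr.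
Qed.

Lemma tmap_tens (f : {linear M -> M'}) (g : {linear N -> N'}) u v :
  tmap f g (u *t v) = f u *t g v.
Proof. exact: tlift_tens (tmap_balanced f g) u v. Qed.

Definition tswap : tensor M N -> tensor N M := tlift (fun u v => v *t u).

Fact tswap_balanced : balanced (fun (u : M) (v : N) => v *t u).
Proof.
split=> [v u1 u2|u v1 v2|a u v]; [exact: tensDr | exact: tensDl |].
by rewrite tensZl tensZr.
Qed.

Lemma tswap_tens u v : tswap (u *t v) = v *t u.
Proof. exact: tlift_tens tswap_balanced u v. Qed.

Lemma tswapZ a z : tswap (a *: z) = a *: tswap z.
Proof. by apply: tliftZ tswap_balanced _ _ _ => *; rewrite tensZr. Qed.

End TensorMaps.

Record submodule (R : comNzRingType) (M : lmodType R) := Submodule {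
  submodule_pred :> {pred M};
  submodule_closed : submod_closed submodule_pred
}.

HB.instance Definition _ (R : comNzRingType) (M : lmodType R)
    (S : submodule M) :=
  GRing.isSubmodClosed.Build R M (submodule_pred S) (submodule_closed S).

Lemma submodule_eqP (R : comNzRingType) (M : lmodType R) (S S' : submodule M) :
  S =i S' <-> S = S'.
Proof.
split=> [|->//]; case: S => p hp; case: S' => q hq eqpq.
have e : p = q by apply/funext => u; exact: eqpq.
by case: q / e in hq eqpq *; congr Submodule; apply: Prop_irrelevance.
Qed.

Record subm (R : comNzRingType) (M : lmodType R) (S : submodule M) := Subm {
  subm_val : M;
  subm_in : subm_val \in submodule_pred S
}.

HB.instance Definition _ (R : comNzRingType) (M : lmodType R)
  (S : submodule M) := [isSub for @subm_val R M S].
HB.instance Definition _ (R : comNzRingType) (M : lmodType R)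
  (S : submodule M) := [Choice of subm S by <:].
HB.instance Definition _ (R : comNzRingType) (M : lmodType R)
  (S : submodule M) := [SubChoice_isSubLmodule of subm S by <:].

(* [S^2(N)]: the tensors in [N (x)_R N] fixed by the exchange of factors. *)
Fact symtensors_closed (R : comNzRingType) (N : lmodType R) :
  submod_closed [pred z : tensor N N | tswap z == z].
Proof.
split=> [|a z w]; rewrite !inE; first by rewrite /tswap (tlift0 (tswap_balanced _ _)).
move=> /eqP zP /eqP wP; rewrite /tswap (tliftD (tswap_balanced _ _)) -!/(tswap _).
by rewrite tswapZ zP wP.
Qed.
Definition symtensors (R : comNzRingType) (N : lmodType R) :
  submodule (tensor N N) := Submodule (symtensors_closed N).

Record orthogonal_group (R : comNzRingType) (L : lmodType R)
    (b : {symmetric L}) := OrthogonalGroup {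
  orth_fun :> {linear L -> L};
  orth_bij : bijective orth_fun;
  orth_isometry : isometry b b orth_fun
}.

Section FormMaps.
Variables (R : comNzRingType) (N L : lmodType R) (b : {symmetric L}).

(* The action is a right action: [u (x) v] is sent to [u (x) (v . g)], where
   [v . g] is the value at [v] of the linear map underlying [g]. *)
Definition orth_act (x : tensor N L) (g : orthogonal_group b) : tensor N L :=
  tmap idfun g x.

Definition same_orbit (x y : tensor N L) : Prop :=
  exists g : orthogonal_group b, orth_act x g = y.

Definition form_map (x : tensor N L) (v : L) : N :=
  tlift (fun u vi => b vi v *: u) x.

Fact form_map_balanced v : balanced (fun (u : N) vi => b vi v *: u).
Proof.
split=> [w u1 u2|u w1 w2|a u w]; first by rewrite scalerDr.
  by rewrite linearDl scalerDl.
by rewrite linearZl_LR scalerA mulrC.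
Qed.

Lemma form_map_sum (s : seq (N * L)) v :
  form_map (\sum_(p <- s) p.1 *t p.2) v = \sum_(p <- s) b p.2 v *: p.1.
Proof. by rewrite -tensor_piE; apply: tlift_pi (form_map_balanced v). Qed.

Fact form_map_linear x : linear (form_map x).
Proof.
move=> a v w; rewrite (tensor_sum x) !form_map_sum scaler_sumr -big_split /=.
by apply: eq_bigr => p _; rewrite linearPr /= scalerDl scalerA.
Qed.

Fact form_im_closed x : submod_closed [pred u | `[< exists v, form_map x v = u >]].
Proof.
split=> [|a u1 u2]; rewrite !inE.
  apply/asboolP; exists 0; have := form_map_linear x (-1) 0 0.
  by rewrite scaler0 addr0 scaleN1r addNr.
move=> /asboolP[v1 <-] /asboolP[v2 <-]; apply/asboolP.
by exists (a *: v1 + v2); apply: form_map_linear.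
Qed.
Definition form_im x : submodule N := Submodule (form_im_closed x).

Definition quad_tensor_val (z : tensor N L) : tensor N N :=
  \sum_(p <- repr z) \sum_(q <- repr z) b p.2 q.2 *: (p.1 *t q.1).

Fact quad_tensor_sym z : quad_tensor_val z \in symtensors N.
Proof.
rewrite inE /=; apply/eqP; rewrite /tswap (tlift_sum (tswap_balanced _ _)).
under eq_bigr do rewrite (tlift_sum (tswap_balanced _ _)).
rewrite exchange_big /=; apply: eq_bigr => p _; apply: eq_bigr => q _.
rewrite -/(tswap _) tswapZ tswap_tens; congr (_ *: _).
by rewrite [LHS]hermC expr0 mul1r.
Qed.

(* [sum_i u_i (x) v_i |-> sum_(i,j) (v_i, v_j) u_i (x) u_j], computed on a chosen
   expression of the argument; see [quad_tensor_sum] for the independence of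
   the choice. *)
Definition quad_tensor (z : tensor N L) : subm (symtensors N) :=
  Subm (quad_tensor_sym z).

Lemma quad_tensor_sum (s : seq (N * L)) :
  subm_val (quad_tensor (\sum_(p <- s) p.1 *t p.2)) =
    \sum_(p <- s) \sum_(q <- s) b p.2 q.2 *: (p.1 *t q.1).
Proof.
rewrite -tensor_piE /= /quad_tensor_val.
set r := repr _; have rs : tensor_rel r s := tensor_repr s.
rewrite -(balanced_rel (f := fun u v => \sum_(q <- s) b v q.2 *: (u *t q.1)) _ rs).
  apply: eq_bigr => p _.
  apply: (balanced_rel (f := fun u v => b p.2 v *: (p.1 *t u)) _ rs).
  split=> [v u1 u2|u v1 v2|a u v]; first by rewrite tensDr scalerDr.
    by rewrite linearDr scalerDl.
  by rewrite linearZr_LR /= tensZr scalerA mulrC.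
split=> [v u1 u2|u v1 v2|a u v].
- by rewrite -big_split; apply: eq_bigr => q _; rewrite tensDl scalerDr.
- by rewrite -big_split; apply: eq_bigr => q _; rewrite linearDl scalerDl.
apply: eq_bigr => q _.
by rewrite linearZl_LR /= tensZl scalerA mulrC.
Qed.

End FormMaps.

(* A finite family together with its dual family with respect to [b]. *)
Definition has_dual_family (R : comNzRingType) (L : lmodType R)
    (b : {symmetric L}) : Prop :=
  exists n (e e' : 'I_n -> L), forall v, v = \sum_k b v (e' k) *: e k.

Section ImageLift.
Variables (R : comNzRingType) (L : lmodType R) (b : {symmetric L}).

Lemma tensor_expand n (e e' : 'I_n -> L) (N : lmodType R) (x : tensor N L) :
  (forall v, v = \sum_k b v (e' k) *: e k) ->
  x = \sum_k form_map b x (e' k) *t e k.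
Proof.
move=> ee'; rewrite [LHS](tensor_sum x).
under [RHS]eq_bigr do rewrite {1}(tensor_sum x) form_map_sum.
have suml k (s : seq (N * L)) : (\sum_(p <- s) b p.2 (e' k) *: p.1) *t e k =
    \sum_(p <- s) p.1 *t (b p.2 (e' k) *: e k).
  rewrite (big_morph (fun u => u *t e k) (tensDl (e k)) (tens0l N (e k))).
  by apply: eq_bigr => p _; rewrite tensZl tensZr.
under [RHS]eq_bigr do rewrite suml.
rewrite exchange_big /=; apply: eq_bigr => p _; rewrite [p.2 in LHS]ee'.
by rewrite (big_morph (tens p.1) (tensDr p.1) (tens0r L p.1)).
Qed.

Hypothesis dualb : has_dual_family b.
Variable N : lmodType R.

Lemma image_lift_ex (x : tensor N L) :
  exists z : tensor (subm (form_im b x)) L, tmap val idfun z = x.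
Proof.
case: dualb => n [e [e' ee']].
have imP k : form_map b x (e' k) \in form_im b x.
  by apply/asboolP; exists (e' k).
exists (\sum_k Subm (imP k) *t e k); rewrite /tmap.
rewrite (tlift_sum (tmap_balanced (val : {linear _ -> _}) idfun)).
rewrite [RHS](tensor_expand x ee'); apply: eq_bigr => k _.
by rewrite -/(tmap _ _ _) tmap_tens.
Qed.

Lemma image_lift_uniq (S : submodule N) (z z' : tensor (subm S) L) :
  tmap val idfun z = tmap val idfun z' -> z = z'.
Proof.
case: dualb => n [e [e' ee']] eqz.
have fval w v : form_map b (tmap val idfun w) v = val (form_map b w v).
  rewrite (tensor_sum w) /tmap.
  rewrite (tlift_sum (tmap_balanced (val : {linear _ -> _}) idfun)).
  under eq_bigr do rewrite -/(tmap _ _ _) tmap_tens.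
  have := form_map_sum b [seq (val p.1, p.2) | p <- repr w] v.
  rewrite !big_map form_map_sum raddf_sum /= => ->.
  by apply: eq_bigr => p _; rewrite linearZ.
rewrite (tensor_expand z ee') (tensor_expand z' ee').
apply: eq_bigr => k _; congr (_ *t _).
by apply: val_inj; rewrite -!fval eqz.
Qed.

(* [x] seen as an element of [Im f_x (x)_R L]. *)
Definition image_lift (x : tensor N L) : tensor (subm (form_im b x)) L :=
  projT1 (cid (image_lift_ex x)).

Lemma image_liftK x : tmap val idfun (image_lift x) = x.
Proof. exact: projT2 (cid (image_lift_ex x)). Qed.

Definition T_tensor (x : tensor N L) : subm (symtensors (subm (form_im b x))) :=
  quad_tensor b (image_lift x).

Lemma T_tensorE (x : tensor N L) (s : seq (subm (form_im b x) * L)) :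
  x = \sum_(p <- s) subm_val p.1 *t p.2 ->
  subm_val (T_tensor x) = \sum_(p <- s) \sum_(q <- s) b p.2 q.2 *: (p.1 *t q.1).
Proof.
move=> xs; rewrite -quad_tensor_sum; congr (subm_val (quad_tensor b _)).
apply: image_lift_uniq; rewrite image_liftK {1}xs /tmap.
rewrite (tlift_sum (tmap_balanced (val : {linear _ -> _}) idfun)).
by apply: eq_bigr => p _; rewrite -/(tmap _ _ _) tmap_tens.
Qed.

End ImageLift.

Definition series (K : comNzRingType) (V : lmodType K) : Type :=
  tensor V {fps K}.
Notation "V [[t]]" := (series V) (at level 1, format "V [[t]]") : type_scope.

Section Series.
Variables (K : comNzRingType) (V : lmodType K).
Implicit Types (a c : {fps K}) (z w : tensor V {fps K}).

Definition series_scale a : tensor V {fps K} -> tensor V {fps K} :=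
  tlift (fun v c => v *t (a * c)).

Fact series_balanced a : balanced (fun v c => v *t (a * c) : tensor V {fps K}).
Proof.
split=> [c v1 v2|v c1 c2|x v c]; first exact: tensDl.
  by rewrite mulrDr tensDr.
by rewrite fps_scalerAr tensZl tensZr.
Qed.

Lemma series_scale_tens a v c : series_scale a (v *t c) = v *t (a * c).
Proof. exact: tlift_tens (series_balanced a) v c. Qed.

Fact series_scaleA a c z :
  series_scale a (series_scale c z) = series_scale (a * c) z.
Proof.
elim/tensor_ind: z => [|v d|z w IHz IHw].
- by rewrite /series_scale !(tlift0 (series_balanced _)).
- by rewrite !series_scale_tens mulrA.
by rewrite /series_scale !(tliftD (series_balanced _)) in IHz IHw *; rewrite IHz IHw.
Qed.

Fact series_scale1 : left_id 1 series_scale.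
Proof.
elim/tensor_ind => [|v d|z w IHz IHw].
- by rewrite /series_scale (tlift0 (series_balanced _)).
- by rewrite series_scale_tens mul1r.
by rewrite /series_scale (tliftD (series_balanced _)) in IHz IHw *; rewrite IHz IHw.
Qed.

Fact series_scaleDr : right_distributive series_scale +%R.
Proof. by move=> a; apply: tliftD (series_balanced a). Qed.

Fact series_scaleDl z : {morph series_scale^~ z : a c / a + c}.
Proof.
move=> a c; elim/tensor_ind: z => [|v d|z w IHz IHw].
- by rewrite /series_scale !(tlift0 (series_balanced _)) addr0.
- by rewrite !series_scale_tens mulrDl tensDr.
by rewrite !series_scaleDr IHz IHw addrACA.
Qed.

HB.instance Definition _ := GRing.Zmodule.copy (V[[t]]) (tensor V {fps K}).
HB.instance Definition _ := GRing.Zmodule_isLmodule.Build {fps K} (V[[t]])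
  series_scaleA series_scale1 series_scaleDr series_scaleDl.

Definition stens (v : V) (c : {fps K}) : V[[t]] := v *t c.

Lemma stensE v c : stens v c = c *: stens v 1.
Proof. by rewrite [RHS]series_scale_tens mulr1. Qed.

Section Form.
Variable b : {symmetric V}.

Definition series_form (z w : V[[t]]) : {fps K} :=
  tlift (fun v c => tlift (fun v' c' => b v v' *: (c * c')) w) z.

Fact series_formr_balanced v c :
  balanced (fun (v' : V) (c' : {fps K}) => b v v' *: (c * c')).
Proof.
split=> [c' v1 v2|v' c1 c2|x v' c']; first by rewrite linearDr scalerDl.
  by rewrite mulrDr scalerDr.
by rewrite linearZr_LR /= fps_scalerAr scalerA mulrC.
Qed.

Fact series_forml_balanced w :
  balanced (fun v c => tlift (fun v' c' => b v v' *: (c * c')) w).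
Proof.
split=> [c v1 v2|v c1 c2|x v c]; rewrite /tlift.
- by rewrite -big_split; apply: eq_bigr => p _; rewrite linearDl scalerDl.
- by rewrite -big_split; apply: eq_bigr => p _; rewrite mulrDl scalerDr.
apply: eq_bigr => p _.
by rewrite linearZl_LR /= fps_scalerAl scalerA mulrC.
Qed.

Lemma series_form_tens v c v' c' :
  series_form (stens v c) (stens v' c') = b v v' *: (c * c').
Proof.
rewrite /series_form (tlift_tens (series_forml_balanced _)).
exact: tlift_tens (series_formr_balanced _ _) _ _.
Qed.

Fact series_formDl w : {morph series_form^~ w : z1 z2 / z1 + z2}.
Proof. exact: tliftD (series_forml_balanced w). Qed.

Fact series_form_sym z w : series_form z w = series_form w z.
Proof.
rewrite /series_form /tlift exchange_big; apply: eq_bigr => p _.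
by apply: eq_bigr => q _; rewrite hermC expr0 mul1r mulrC.
Qed.

Fact series_formZl w a (z : V[[t]]) : series_form (a *: z) w = a * series_form z w.
Proof.
elim/tensor_ind: z => [|v c|z1 z2 IH1 IH2].
- rewrite (_ : (0 : tensor V _) = (0 : V[[t]])) // scaler0.
  by rewrite /series_form (tlift0 (series_forml_balanced w)) mulr0.
- rewrite [_ *: _]series_scale_tens /series_form.
  rewrite !(tlift_tens (series_forml_balanced _)) /tlift mulr_sumr.
  by apply: eq_bigr => p _; rewrite fps_scalerAr mulrA.
rewrite (_ : (z1 + z2 : tensor V _) = (z1 : V[[t]]) + z2) // scalerDr.
by rewrite !series_formDl IH1 IH2 mulrDr.
Qed.

Fact series_form_bilinear :
  bilinear_for ( *%R : {fps K} -> {fps K} -> {fps K})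
    ( *%R : {fps K} -> {fps K} -> {fps K}) series_form.
Proof.
split=> [w a z1 z2|w a z1 z2]; first by rewrite series_formDl series_formZl.
by rewrite ![series_form w _]series_form_sym series_formDl series_formZl.
Qed.

HB.instance Definition _ := bilinear_isBilinear.Build {fps K} V[[t]] V[[t]]
  {fps K} *%R (idfun \; *%R) series_form series_form_bilinear.

Fact series_form_herm z w :
  series_form z w = (-1) ^+ false * idfun (series_form w z).
Proof. by rewrite expr0 mul1r series_form_sym. Qed.

HB.instance Definition _ := isHermitianSesquilinear.Build {fps K} V[[t]]
  false idfun series_form series_form_herm.

End Form.
End Series.

Lemma nondegenerate_dual (F : fieldType) (V : vectType F) (b : {symmetric V}) :
  nondegenerate b ->
  exists n (e e' : 'I_n -> V), forall v, v = \sum_k b v (e' k) *: e k.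
Proof.
move=> nondeg; pose n := \dim {:V}; pose e (k : 'I_n) := (vbasis {:V})`_k.
pose f (v : V) : 'rV[F]_n := \row_k b (e k) v.
have f_lin : linear f.
  by move=> a u v; apply/rowP=> k; rewrite !mxE linearPr.
pose fL := GRing.isLinear.Build F V 'rV[F]_n *:%R f f_lin.
pose fl : {linear V -> 'rV[F]_n} := HB.pack f fL.
pose h : 'Hom(V, 'rV[F]_n) := linfun fl.
have ker0 : lker h == 0%VS.
  rewrite -subv0; move/eqP: nondeg => <-; apply/subvP => v.
  rewrite memv_ker lfunE => /eqP/rowP hv; apply/mem_orthovP => w _.
  rewrite (coord_vbasis (memvf w)) linear_sumr big1 // => k _.
  rewrite linearZr_LR /= hermC expr0 mul1r.
  by have := hv k; rewrite !mxE /= => ->; rewrite mulr0.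
have imh : limg h = fullv.
  apply/eqP; rewrite eqEdim subvf /= limg_dim_eq; last first.
    by move/eqP: ker0 => ->; rewrite capv0.
  by rewrite (dimvf 'rV[F]_n) /dim /= mul1n.
exists n, e, (fun k => (h^-1)%VF (delta_mx 0 k)) => v.
rewrite [LHS](coord_vbasis (memvf v)); apply: eq_bigr => k _; congr (_ *: _).
have hk : f ((h^-1)%VF (delta_mx 0 k)) = delta_mx 0 k.
  by rewrite -[f _]/(fl _) -lfunE limg_lfunVK // imh memvf.
rewrite [in RHS](coord_vbasis (memvf v)) linear_sumlz (bigD1 k) //=.
have bk (j : 'I_n) : b (vbasis {:V})`_j ((h^-1)%VF (delta_mx 0 k)) = (j == k)%:R.
  by have := congr1 (fun r : 'rV_n => r 0 j) hk; rewrite !mxE eqxx.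
rewrite linearZl_LR /= bk eqxx mulr1 big1 ?addr0 // => j /negPf neqjk.
by rewrite linearZl_LR /= bk neqjk mulr0.
Qed.

Lemma series_dual_family (F : fieldType) (V : vectType F) (b : {symmetric V}) :
  nondegenerate b -> has_dual_family (series_form b : {symmetric V[[t]]}).
Proof.
move=> /nondegenerate_dual[n [e [e' ee']]].
exists n, (fun k => stens (e k) 1), (fun k => stens (e' k) 1).
elim/tensor_ind => [|v c|z w IHz IHw].
- apply/esym/big1 => k _; apply: etrans (scale0r (stens (e k) 1)).
  by congr (_ *: _); apply: tlift0 (series_forml_balanced _ _).
- rewrite [in LHS](ee' v) (big_morph (fun u => u *t c) (tensDl c) (tens0l V c)).
  apply: eq_bigr => k _; transitivity ((b v (e' k) *: c) *: stens (e k) 1).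
    by rewrite -stensE /stens tensZr tensZl.
  congr (_ *: _); rewrite -[c in LHS]mulr1.
  exact/esym/(series_form_tens b v c (e' k) 1).
rewrite {1}IHz {1}IHw -big_split; apply: eq_bigr => k _ /=.
pose g (x : V[[t]]) := series_form b x (stens (e' k) 1).
apply/esym; transitivity ((g z + g w) *: stens (e k) 1); last exact: scalerDl.
by congr (_ *: _); apply: series_formDl.
Qed.

Record sntModule (F : fieldType) := SntModule {
  snt_sort :> vectType F;
  snt_t : 'End(snt_sort);
  snt_form : {skew_symmetric snt_sort};
  snt_nilpotent : exists k, forall u, iter k snt_t u = 0;
  snt_symplectic : is_psymplectic snt_form;
  snt_adjoint : forall u v, snt_form (snt_t u) v = snt_form u (snt_t v)
}.

Section SntAction.
Variables (F : fieldType) (M : sntModule F).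
Implicit Types (a c : {fps F}) (u : M).

Let k := projT1 (cid (snt_nilpotent M)).

(* The sum is finite because [t ^ k] acts as zero; [snt_actE] shows that the
   choice of [k] does not matter. *)
Definition snt_act a u : M := \sum_(i < k) a i *: iter i (snt_t M) u.

Let iter_t0 i : iter i (snt_t M) 0 = 0.
Proof. by elim: i => //= i ->; rewrite linear0. Qed.

Let iter_tD i : {morph iter i (snt_t M) : u v / u + v}.
Proof. by elim: i => [|i IHi] u v //=; rewrite IHi linearD. Qed.

Let iter_tZ i x : {morph iter i (snt_t M) : u / x *: u}.
Proof. by elim: i => [|i IHi] u //=; rewrite IHi linearZ. Qed.

Let iter_t_ge i u : (k <= i)%N -> iter i (snt_t M) u = 0.
Proof.
move=> leki; rewrite -(subnK leki) iterD.
by rewrite (projT2 (cid (snt_nilpotent M))) iter_t0.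
Qed.

Let snt_act_wide n a u :
  (k <= n)%N -> snt_act a u = \sum_(i < n) a i *: iter i (snt_t M) u.
Proof.
move=> lekn; rewrite /snt_act (big_ord_widen n (fun i => a i *: iter i (snt_t M) u)) //.
rewrite big_mkcond; apply: eq_bigr => i _; case: ltnP => // leki.
by rewrite iter_t_ge // scaler0.
Qed.

Lemma snt_actE n a u : (forall v, iter n (snt_t M) v = 0) ->
  snt_act a u = \sum_(i < n) a i *: iter i (snt_t M) u.
Proof.
move=> tn0; rewrite (@snt_act_wide (n + k)%N) ?leq_addl //.
rewrite big_split_ord /= [X in _ + X]big1 ?addr0 // => i _.
by rewrite addnC iterD tn0 iter_t0 scaler0.
Qed.

Fact snt_act1 : left_id 1 snt_act.
Proof.
move=> u; rewrite (@snt_act_wide k.+1) // big_ord_recl /= scale1r.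
by rewrite big1 ?addr0 // => i _; rewrite scale0r.
Qed.

Fact snt_actDr : right_distributive snt_act +%R.
Proof.
move=> a u v; rewrite /snt_act -big_split; apply: eq_bigr => i _ /=.
by rewrite -scalerDr -iter_tD.
Qed.

Fact snt_actDl u : {morph snt_act^~ u : a c / a + c}.
Proof.
move=> a c; rewrite /snt_act -big_split; apply: eq_bigr => i _ /=.
by rewrite -scalerDl.
Qed.

Fact snt_actA a c u : snt_act a (snt_act c u) = snt_act (a * c) u.
Proof.
pose G i j := (a i * c j) *: iter (i + j) (snt_t M) u.
transitivity (\sum_(i < k) \sum_(j < k) G i j).
  apply: eq_bigr => i _; rewrite /snt_act.
  rewrite (big_morph _ (iter_tD i) (iter_t0 i)) scaler_sumr.
  by apply: eq_bigr => j _; rewrite iter_tZ scalerA -iterD.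
have fG i : \sum_(j < k) G i j = \sum_(n < k | (i <= n)%N) G i (n - i)%N.
  transitivity (\sum_(0 + i <= n < k) G i (n - i)%N); last first.
    by rewrite add0n (big_nat_widenl _ 0) // big_mkord.
  rewrite big_addn; under [RHS]eq_bigr do rewrite addnK.
  rewrite -(big_mkord xpredT (G i)).
  rewrite (big_cat_nat (n := k - i)) ?leq_subr //= [X in _ + X]big1_seq ?addr0 //.
  move=> j; rewrite mem_index_iota => /andP[_ /andP[lekj _]].
  by rewrite /G iter_t_ge ?scaler0 // -leq_subLR.
under eq_bigr do rewrite fG.
rewrite (exchange_big_dep xpredT) //=; apply: eq_bigr => n _.
rewrite [in RHS]/GRing.mul /= /fps_mul scaler_suml.
rewrite (big_ord_widen_cond k xpredT (fun i => (a i * c (n - i)%N) *: iter n (snt_t M) u)) //.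
by apply: eq_big => [i|i lein]; rewrite ?ltnS // /G subnKC.
Qed.

End SntAction.

(* [M] regarded as an [F[[t]]]-module. *)
Definition snt_mod (F : fieldType) (M : sntModule F) : Type := snt_sort M.

HB.instance Definition _ (F : fieldType) (M : sntModule F) :=
  GRing.Zmodule.copy (snt_mod M) (snt_sort M).
HB.instance Definition _ (F : fieldType) (M : sntModule F) :=
  GRing.Zmodule_isLmodule.Build {fps F} (snt_mod M)
    (@snt_actA F M) (@snt_act1 F M) (@snt_actDr F M) (@snt_actDl F M).

Section SntSubspaces.
Variables (F : fieldType) (M : sntModule F).
Implicit Types U : {vspace M}.

Definition snt_stable U : Prop :=
  forall (a : {fps F}) (u : snt_mod M),
    (u : M) \in U -> (a *: u : snt_mod M) \in U.

Definition lagrangian U : Prop := orthov (snt_form M) U = U.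

Fact snt_sub_closed U : snt_stable U -> submod_closed [pred u : snt_mod M | u \in U].
Proof.
move=> stU; split=> [|a u v]; rewrite !inE; first exact: mem0v.
by move=> uU vU; apply: memvD => //; apply: stU.
Qed.
Definition snt_submodule U (stU : snt_stable U) : submodule (snt_mod M) :=
  Submodule (snt_sub_closed stU).

Lemma snt_constZ (x : F) (a : {fps F}) (u : snt_mod M) :
  ((x *: a) *: u : snt_mod M) = x *: ((a *: u : snt_mod M) : M).
Proof.
change (snt_act (x *: a) (u : M) = x *: snt_act a (u : M)).
rewrite /snt_act scaler_sumr.
by apply: eq_bigr => i _; rewrite scalerA.
Qed.

Variables (U : {vspace M}) (stU : snt_stable U) (V : vectType F).

(* [U] as an [F[[t]]]-module; as an [F]-vector space it is [subvs_of U]. *)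
Local Notation snt_sub := (subm (snt_submodule stU)).

Definition to_snt_sub (u : subvs_of U) : snt_sub :=
  @Subm _ _ (snt_submodule stU) (vsval u) (subvsP u).
Definition of_snt_sub (u : snt_sub) : subvs_of U := vsproj U (subm_val u).

Lemma to_snt_subK : cancel to_snt_sub of_snt_sub.
Proof. by move=> u; rewrite /of_snt_sub /= vsvalK. Qed.
Lemma of_snt_subK : cancel of_snt_sub to_snt_sub.
Proof. by move=> [u uU]; apply: val_inj; rewrite /= vsprojK. Qed.

(* The identification of [U (x)_F V] with [U (x)_{F[[t]]} V[[t]]], sending
   [u (x) v] to [u (x) (v (x) 1)]; it is bijective by [scalar_ext_bij]. *)
Definition scalar_ext : tensor (subvs_of U) V -> tensor snt_sub V[[t]] :=
  tlift (fun u v => to_snt_sub u *t stens v 1).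

Fact scalar_ext_balanced :
  balanced (fun (u : subvs_of U) (v : V) => to_snt_sub u *t stens v 1).
Proof.
split=> [v u1 u2|u v1 v2|a u v].
- by rewrite -tensDl; congr (_ *t _); apply: val_inj; exact: (linearD vsval).
- by rewrite -tensDr; congr (_ *t _); apply: tensDl.
have -> : to_snt_sub (a *: u) = (a *: (1 : {fps F})) *: to_snt_sub u.
  apply: val_inj; apply: esym; apply: etrans (snt_constZ a 1 (vsval u)) _.
  by rewrite scale1r.
rewrite tensZl -tensZr -stensE; congr (_ *t _).
by rewrite /stens tensZl tensZr.
Qed.

Definition scalar_ext_inv : tensor snt_sub V[[t]] -> tensor (subvs_of U) V :=
  tlift (fun (m : snt_sub) (w : V[[t]]) =>
    tlift (fun (v : V) (c : {fps F}) => of_snt_sub (c *: m) *t v) w).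

Fact scalar_ext_invr_balanced m :
  balanced (fun (v : V) (c : {fps F}) => of_snt_sub (c *: m) *t v).
Proof.
split=> [c v1 v2|v c1 c2|a v c]; first exact: tensDr.
  by rewrite scalerDl /of_snt_sub /= linearD tensDl.
rewrite tensZr -tensZl; congr (_ *t _).
by rewrite /of_snt_sub /= (snt_constZ a c) linearZ.
Qed.

Fact scalar_ext_inv_balanced :
  balanced (fun (m : snt_sub) (w : V[[t]]) =>
    tlift (fun (v : V) (c : {fps F}) => of_snt_sub (c *: m) *t v) w).
Proof.
split=> [w m1 m2|m w1 w2|a m w].
- rewrite /tlift -big_split; apply: eq_bigr => p _ /=.
  by rewrite -tensDl scalerDr /of_snt_sub /= linearD.
- exact: tliftD (scalar_ext_invr_balanced m) w1 w2.
elim/tensor_ind: w => [|v c|w1 w2 IH1 IH2].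
- rewrite (tlift0 (scalar_ext_invr_balanced _)).
  apply: esym; apply: etrans (tlift0 (scalar_ext_invr_balanced m)).
  by congr tlift; apply: (scaler0 V[[t]] a).
- rewrite (tlift_tens (scalar_ext_invr_balanced _)) [X in tlift _ X](series_scale_tens a v c).
  by rewrite (tlift_tens (scalar_ext_invr_balanced _)) scalerA mulrC.
rewrite (tliftD (scalar_ext_invr_balanced _)) IH1 IH2.
rewrite -(tliftD (scalar_ext_invr_balanced m)); congr tlift.
by apply/esym/(scalerDr a (w1 : V[[t]]) w2).
Qed.

Lemma scalar_ext_bij : bijective scalar_ext.
Proof.
exists scalar_ext_inv.
  elim/tensor_ind=> [|u v|x y IHx IHy].
  - by rewrite /scalar_ext (tlift0 scalar_ext_balanced) /scalar_ext_inv
      (tlift0 scalar_ext_inv_balanced).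
  - rewrite /scalar_ext (tlift_tens scalar_ext_balanced) /scalar_ext_inv.
    rewrite (tlift_tens scalar_ext_inv_balanced).
    by rewrite (tlift_tens (scalar_ext_invr_balanced _)) scale1r to_snt_subK.
  rewrite /scalar_ext (tliftD scalar_ext_balanced) /scalar_ext_inv.
  by rewrite (tliftD scalar_ext_inv_balanced); congr (_ + _).
elim/tensor_ind=> [|m w|x y IHx IHy].
- by rewrite /scalar_ext_inv (tlift0 scalar_ext_inv_balanced) /scalar_ext
    (tlift0 scalar_ext_balanced).
- rewrite /scalar_ext_inv (tlift_tens scalar_ext_inv_balanced).
  elim/tensor_ind: w => [|v c|w1 w2 IH1 IH2].
  + rewrite (tlift0 (scalar_ext_invr_balanced _)).
    rewrite /scalar_ext (tlift0 scalar_ext_balanced).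
    exact/esym/(tens0r V[[t]] m).
  + rewrite (tlift_tens (scalar_ext_invr_balanced _)).
    rewrite /scalar_ext (tlift_tens scalar_ext_balanced) of_snt_subK.
    by rewrite tensZl -tensZr -stensE.
  rewrite (tliftD (scalar_ext_invr_balanced _)).
  rewrite /scalar_ext (tliftD scalar_ext_balanced) -!/(scalar_ext _) IH1 IH2.
  exact/esym/(tensDr m (w1 : V[[t]]) w2).
rewrite /scalar_ext_inv (tliftD scalar_ext_inv_balanced) /scalar_ext.
by rewrite (tliftD scalar_ext_balanced); congr (_ + _).
Qed.

End SntSubspaces.

(* Main.v *)
(** Write [R = F[[t]]], [L = V[[t]]] and [S = Im f_x = Im f_y].  Since [S] is
    killed by a power of [t], it has generators [s_1, ..., s_r] all of whose
    relations follow from [t ^ (d i) s_i = 0], with [d i > 0].  Writing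
    [x = \sum_i s_i (x) v_i] and [y = \sum_i s_i (x) w_i], surjectivity of [f_x] and
    [f_y] onto [S] says that the [v_i], and the [w_i], are linearly independent
    modulo [t], and [T x = T y] says that [(v_i, v_j)] and [(w_i, w_j)] agree modulo
    [t ^ min (d i, d j)].  Witt's theorem over [F] reduces to the case
    [v_i = w_i] modulo [t].  Completing both families by the same constant vectors
    (with [d i = 1]) to bases of [L], a contraction argument modifies each [w_i] by
    an element of [t ^ (d i) L], which does not affect [y], so that the two Gram
    matrices coincide; the change of basis is then the required isometry. *)
From HB Require Import structures.
Require Import Defs.
From mathcomp Require Import all_boot all_order all_algebra all_field.
From mathcomp Require Import sesquilinear.
From mathcomp Require Import ring zify boolp.

Set Implicit Arguments.
Unset Strict Implicit.
Unset Printing Implicit Defensive.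

Import GRing.Theory.
Local Open Scope ring_scope.

(** * Power series and matrices of power series *)

Section PowerSeries.
Variable K : comNzRingType.
Implicit Types (a c : {fps K}) (m n k : nat).

Lemma fpsD a c n : (a + c) n = a n + c n. Proof. by []. Qed.
Lemma fpsN a n : (- a) n = - a n. Proof. by []. Qed.
Lemma fpsM a c n : (a * c) n = \sum_(i < n.+1) a i * c (n - i)%N.
Proof. by []. Qed.

(** Reduction modulo [t], a ring morphism split by [fps_const]; applied entrywise, it commutes with
    forming Gram matrices. *)
Definition coef0 a : K := a 0%N.

Fact coef0_zmod_morphism : zmod_morphism coef0. Proof. by []. Qed.
Fact coef0_monoid_morphism : monoid_morphism coef0.
Proof. by split=> // a c; rewrite /coef0 fpsM big_ord1. Qed.
HB.instance Definition _ :=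
  GRing.isZmodMorphism.Build {fps K} K coef0 coef0_zmod_morphism.
HB.instance Definition _ :=
  GRing.isMonoidMorphism.Build {fps K} K coef0 coef0_monoid_morphism.

Fact fps_const_zmod_morphism : zmod_morphism (@fps_const K).
Proof. by move=> x y; apply/funext=> n; rewrite /fps_const mulrnBl. Qed.
Fact fps_const_monoid_morphism : monoid_morphism (@fps_const K).
Proof.
split=> // x y; rewrite (fps_const_mul x (fps_const y)); apply/funext=> n.
by rewrite [RHS]/GRing.scale /= /fps_scale /fps_const mulrnAr.
Qed.
HB.instance Definition _ :=
  GRing.isZmodMorphism.Build K {fps K} (@fps_const K) fps_const_zmod_morphism.
HB.instance Definition _ :=
  GRing.isMonoidMorphism.Build K {fps K} (@fps_const K) fps_const_monoid_morphism.

Lemma fps_constK : cancel (@fps_const K) coef0.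
Proof. by move=> x; rewrite /coef0 /fps_const mulr1n. Qed.

Definition fps_Xn m : {fps K} := fun n => (n == m)%:R.

Lemma fps_XnM m a n : (fps_Xn m * a) n = if (m <= n)%N then a (n - m)%N else 0.
Proof.
rewrite fpsM /fps_Xn; case: ifPn => [le_mn | lt_nm]; last first.
  by apply: big1 => i _; rewrite ltn_eqF ?mul0r //; have := ltn_ord i; lia.
have lt_mn : (m < n.+1)%N by [].
rewrite (bigD1 (Ordinal lt_mn)) //= eqxx mul1r big1 ?addr0 // => i.
by rewrite -val_eqE /= => /negPf ->; rewrite mul0r.
Qed.

(* [low m a] says that [t ^ m] divides [a]. *)
Definition low m a : Prop := forall n, (n < m)%N -> a n = 0.

Lemma lowP m a : low m a <-> exists c, a = fps_Xn m * c.
Proof.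
split=> [lowa | [c ->] n lt_nm]; last by rewrite fps_XnM leqNgt lt_nm.
exists (fun n => a (n + m)%N); apply/funext=> n; rewrite fps_XnM.
by case: leqP => [/subnK ->|/lowa].
Qed.

Lemma lowW m n a : (n <= m)%N -> low m a -> low n a.
Proof. by move=> le_nm lowa k lt_kn; apply: lowa; apply: leq_trans le_nm. Qed.

Lemma lowD m a c : low m a -> low m c -> low m (a + c).
Proof. by move=> la lc n ltn; rewrite fpsD la ?lc ?addr0. Qed.

Lemma lowN m a : low m a -> low m (- a).
Proof. by move=> la n ltn; rewrite fpsN la ?oppr0. Qed.

Lemma lowB m a c : low m a -> low m c -> low m (a - c).
Proof. by move=> la /lowN; apply: lowD. Qed.

Lemma lowMr m a c : low m a -> low m (a * c).
Proof. by move=> /lowP[d ->]; apply/lowP; exists (d * c); rewrite mulrA. Qed.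

Lemma lowMl m a c : low m a -> low m (c * a).
Proof. by rewrite mulrC; apply: lowMr. Qed.

Lemma low_XnM m k a : low k a -> low (m + k) (fps_Xn m * a).
Proof.
move=> lowa n ltn; rewrite fps_XnM; case: leqP => // le_mn.
by apply: lowa; rewrite ltn_subLR.
Qed.

Lemma low_sum (I : finType) m (E : I -> {fps K}) :
  (forall i, low m (E i)) -> low m (\sum_i E i).
Proof. by move=> lowE; elim/big_ind: _ => // a c; apply: lowD. Qed.

Lemma low_eq a c : (forall m, low m (a - c)) -> a = c.
Proof.
by move=> lowac; apply/funext=> n; apply/eqP; rewrite -subr_eq0; apply/eqP/(lowac n.+1).
Qed.

Definition lowmx m p q (A : 'M[{fps K}]_(p, q)) : Prop := forall i j, low m (A i j).

Section LowMatrix.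
Variables p q : nat.
Implicit Types A C : 'M[{fps K}]_(p, q).

Lemma lowmxD m A C : lowmx m A -> lowmx m C -> lowmx m (A + C).
Proof. by move=> lA lC i j; rewrite mxE; apply: lowD. Qed.

Lemma lowmxN m A : lowmx m A -> lowmx m (- A).
Proof. by move=> lA i j; rewrite mxE; apply: lowN. Qed.

Lemma lowmx_tr m A : lowmx m A -> lowmx m A^T.
Proof. by move=> lA i j; rewrite mxE. Qed.

Lemma lowmxMr m s A (D : 'M_(q, s)) : lowmx m A -> lowmx m (A *m D).
Proof. by move=> lA i j; rewrite mxE; apply: low_sum => k; apply: lowMr. Qed.

Lemma lowmxMl m s A (D : 'M_(s, p)) : lowmx m A -> lowmx m (D *m A).
Proof. by move=> lA i j; rewrite mxE; apply: low_sum => k; apply: lowMl. Qed.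

Lemma lowmx_XnZ m k A : lowmx m A -> lowmx (k + m) (fps_Xn k *: A).
Proof. by move=> lA i j; rewrite mxE; apply: low_XnM. Qed.

Lemma lowmx_eq A C : (forall k, lowmx k (A - C)) -> A = C.
Proof.
move=> lAC; apply/matrixP=> i j; apply: low_eq => k.
by have := lAC k i j; rewrite !mxE.
Qed.

Lemma lowmxP m A : lowmx m A -> exists D, A = fps_Xn m *: D.
Proof.
move=> lA; exists (\matrix_(i, j) (fun n => A i j (n + m)%N)).
apply/matrixP=> i j; rewrite !mxE; apply/funext=> n; rewrite fps_XnM.
by case: leqP => [le_mn|/lA]; rewrite ?subnK.
Qed.

Lemma lowmx1P A : map_mx coef0 A = 0 -> exists D, A = fps_Xn 1 *: D.
Proof.
move=> A0; apply: lowmxP => i j [|//] _.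
by have /matrixP/(_ i j) := A0; rewrite !mxE.
Qed.

(* The [n]-th coefficient of the fixed point is that of the [n.+1]-st iterate. *)
Lemma contraction_fixpoint (Phi : 'M[{fps K}]_(p, q) -> 'M[{fps K}]_(p, q)) :
    (forall n A C, lowmx n (A - C) -> lowmx n.+1 (Phi A - Phi C)) ->
  exists A, Phi A = A.
Proof.
move=> contr; pose it n := iter n Phi 0.
have it_step n : lowmx n (it n.+1 - it n).
  by elim: n => [|n IHn]; [by move=> i j k; rewrite ltn0 | exact: contr].
have it_le n k : (n <= k)%N -> lowmx n (it k - it n).
  move=> /subnK <-; elim: (k - n)%N => [|l IHl]; first by rewrite add0n subrr => i j; rewrite mxE.
  have -> : it (l.+1 + n)%N - it n = (it (l + n).+1 - it (l + n)%N) + (it (l + n)%N - it n).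
    by rewrite addrA subrK.
  apply: (lowmxD _ IHl) => i j.
  by apply: lowW (it_step _ i j); rewrite leq_addl.
pose A : 'M[{fps K}]_(p, q) := \matrix_(i, j) (fun n => it n.+1 i j n).
have A_it n : lowmx n (A - it n).
  move=> i j k lt_kn; rewrite !mxE fpsD fpsN.
  have := it_le k.+1 n lt_kn i j k (leqnn _); rewrite !mxE fpsD fpsN => /eqP.
  by rewrite subr_eq0 => /eqP ->; rewrite subrr.
exists A; apply: lowmx_eq => n i j k lt_kn.
have : lowmx k.+1 (Phi A - A).
  rewrite -(subrK (it k.+1) (Phi A)) -addrA; apply: lowmxD; first exact/contr/A_it.
  by rewrite -opprB; apply/lowmxN/A_it.
by apply.
Qed.

End LowMatrix.
End PowerSeries.

(** * Matrices invertible modulo [t] *)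

Section FieldPowerSeries.
Variable F : fieldType.
Local Notation R := {fps F}.

(** Write [A = A0 + t D] with [A0] constant. The equation [A C = 1] becomes [C = A0^-1 (1 - t D C)],
    whose right-hand side is a contraction because of the factor [t]. *)
Lemma fps_mx_inverse n (A : 'M[R]_n) : map_mx (@coef0 F) A \in unitmx ->
  exists C, A *m C = 1%:M /\ C *m A = 1%:M.
Proof.
set A0 := map_mx _ A => A0_unit.
pose cst (D : 'M[F]_n) := map_mx (@fps_const F) D.
have cstK D : map_mx (@coef0 F) (cst D) = D.
  by apply/matrixP=> i j; rewrite !mxE fps_constK.
have [|D defD] := @lowmx1P _ _ _ (A - cst A0).
  by rewrite map_mxB cstK subrr.
pose Phi C := cst (invmx A0) *m (1%:M - fps_Xn F 1 *: (D *m C)).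
have [C PhiC] : exists C, Phi C = C.
  apply: contraction_fixpoint => k C1 C2 lowC.
  have -> : Phi C1 - Phi C2 = cst (invmx A0) *m - (fps_Xn F 1 *: (D *m (C1 - C2))).
    by rewrite -mulmxBr; congr (_ *m _); rewrite mulmxBr scalerBr !opprB addrC addrA subrK.
  by apply/lowmxMl/lowmxN/(@lowmx_XnZ _ _ _ k 1)/lowmxMl.
have AC : A *m C = 1%:M.
  rewrite -(subrK (cst A0) A) mulmxDl defD -scalemxAl -{2}PhiC mulmxA -map_mxM.
  by rewrite mulmxV // map_mx1 mul1mx addrC subrK.
by exists C; split=> //; apply: mulmx1C.
Qed.

Lemma fps_inverse (a : R) : a 0%N != 0 -> exists c, a * c = 1.
Proof.
move=> a0; have [|C [aC _]] := @fps_mx_inverse 1 a%:M.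
  by rewrite map_scalar_mx unitmxE det_scalar1 unitfE.
exists (C 0 0); have /matrixP/(_ 0 0) := aC.
by rewrite mul_scalar_mx !mxE.
Qed.

End FieldPowerSeries.

(** * Witt's theorem over a field *)

Section Witt.
Variables (F : fieldType) (n : nat) (B : 'M[F]_n).
Hypotheses (two_neq0 : (2%:R : F) != 0) (B_sym : B^T = B).
Implicit Types (H : 'M[F]_n) (x y z u : 'rV[F]_n).

(** Vectors are rows and matrices act on the right, in agreement with the right action of [G]; the
    rows of [X] have Gram matrix [X B X^T]. *)
Definition orthogonal_mx H : Prop := H *m B *m H^T = B.

Lemma orthogonal_mxM H1 H2 :
  orthogonal_mx H1 -> orthogonal_mx H2 -> orthogonal_mx (H2 *m H1).
Proof.
by rewrite /orthogonal_mx trmx_mul !mulmxA => H1B H2B; rewrite -(mulmxA H2) -(mulmxA H2) H1B.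
Qed.

Lemma gram_orthogonal r s (X : 'M_(r, n)) (Y : 'M_(s, n)) H :
  orthogonal_mx H -> (X *m H) *m B *m (Y *m H)^T = X *m B *m Y^T.
Proof. by move=> HB; rewrite trmx_mul !mulmxA -(mulmxA X) -(mulmxA X) HB. Qed.

Lemma gram_tr r s (X : 'M_(r, n)) (Y : 'M_(s, n)) :
  (X *m B *m Y^T)^T = Y *m B *m X^T.
Proof. by rewrite !trmx_mul trmxK B_sym mulmxA. Qed.

Definition dot x y : F := (x *m B *m y^T) 0 0.

Lemma dotE x y : x *m B *m y^T = (dot x y)%:M.
Proof. exact: mx11_scalar. Qed.

Lemma dotC x y : dot x y = dot y x.
Proof. by rewrite /dot -gram_tr mxE. Qed.

Lemma dotDl x y z : dot (x + y) z = dot x z + dot y z.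
Proof. by rewrite /dot !mulmxDl mxE. Qed.

Lemma dotDr x y z : dot z (x + y) = dot z x + dot z y.
Proof. by rewrite dotC dotDl !(dotC _ z). Qed.

Lemma dotNl x y : dot (- x) y = - dot x y.
Proof. by rewrite /dot !mulNmx mxE. Qed.

Lemma dotNr x y : dot y (- x) = - dot y x.
Proof. by rewrite dotC dotNl dotC. Qed.

Lemma dotZl a x y : dot (a *: x) y = a * dot x y.
Proof. by rewrite /dot -!scalemxAl mxE. Qed.

Lemma dotZr a x y : dot x (a *: y) = a * dot x y.
Proof. by rewrite dotC dotZl dotC. Qed.

Definition dot_simp := (dotDl, dotDr, dotNl, dotNr, dotZl, dotZr).

(** The matrix of [z |-> z - 2 (z, u) / (u, u) u], the reflection in the hyperplane orthogonal to
    [u]. *)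
Definition reflection u : 'M[F]_n :=
  1%:M - (2%:R / dot u u) *: (B *m u^T *m u).

Lemma mul_reflection z u :
  z *m reflection u = z - (2%:R * dot z u / dot u u) *: u.
Proof.
rewrite mulmxBr mulmx1 -scalemxAr !mulmxA dotE mul_scalar_mx scalerA.
by rewrite mulrAC.
Qed.

Lemma reflection_orthogonal u : dot u u != 0 -> orthogonal_mx (reflection u).
Proof.
move=> u0; apply/matrixP => i j.
have entryE (A : 'M[F]_n) k l :
    ((delta_mx 0 k : 'rV_n) *m A *m (delta_mx 0 l : 'rV_n)^T) 0 0 = A k l.
  by rewrite trmx_delta -colE -rowE !mxE.
have dot_refl x y : dot (x *m reflection u) (y *m reflection u) = dot x y.
  rewrite !mul_reflection !dot_simp (dotC u y).
  set a := dot x u; set c := dot y u.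
  by field.
apply: etrans (esym (entryE _ i j)) _; rewrite -[RHS]entryE -!/(dot _ _) -dot_refl.
by rewrite /dot trmx_mul !mulmxA.
Qed.

(* One of [x - y] and [x + y] is anisotropic since
   [q (x - y) + q (x + y) = 4 q x]; in the second case [x] is first sent to
   [- y], and then to [y] by the reflection in [y] itself. *)
Lemma anisotropic_transport x y : dot x x = dot y y -> dot x x != 0 ->
  exists H, [/\ orthogonal_mx H, x *m H = y &
    forall z, dot z x = 0 -> dot z y = 0 -> z *m H = z].
Proof.
move=> qxy qx0.
have [qB0 | qB] := eqVneq (dot (x - y) (x - y)) 0; last first.
  exists (reflection (x - y)); split=> [||z zx zy].
  - exact: reflection_orthogonal.
  - rewrite mul_reflection.
    have -> : 2%:R * dot x (x - y) = dot (x - y) (x - y).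
      by rewrite !dot_simp (dotC y x) -qxy; ring.
    by rewrite divff // scale1r opprB addrC subrK.
  by rewrite mul_reflection dotDr dotNr zx zy subr0 mulr0 mul0r scale0r subr0.
have qD : dot (x + y) (x + y) = 2%:R * 2%:R * dot x x.
  rewrite -[LHS]addr0 -qB0 !dot_simp (dotC y x) -qxy; ring.
have qD0 : dot (x + y) (x + y) != 0 by rewrite qD !mulf_neq0.
exists (reflection (x + y) *m reflection y); split=> [||z zx zy].
- by apply: orthogonal_mxM; apply: reflection_orthogonal; rewrite // -qxy.
- rewrite mulmxA (mul_reflection x).
  have -> : 2%:R * dot x (x + y) = dot (x + y) (x + y).
    by rewrite !dot_simp (dotC y x) -qxy; ring.
  rewrite divff // scale1r opprD addrA subrr add0r mul_reflection dotNl mulrN mulNr.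
  by rewrite mulfK -?qxy // scaleNr opprK scaler_nat mulr2n addrA addNr add0r.
have zR u : dot z u = 0 -> z *m reflection u = z.
  by move=> zu; rewrite mul_reflection zu mulr0 mul0r scale0r subr0.
by rewrite mulmxA !zR // dotDr zx zy addr0.
Qed.

(** Polarization: if the quadratic form vanishes identically, its value at [e_i + e_j] is [2 G_ij],
    and 2 is invertible. *)
Lemma exists_anisotropic r (G : 'M[F]_r) : G^T = G -> G != 0 ->
  exists a : 'rV_r, a *m G *m a^T != 0.
Proof.
move=> G_sym; apply: contraNP => /forallNP q0; apply/eqP.
have {}q0 (a : 'rV_r) : a *m G *m a^T = 0 by apply/eqP; move: (q0 a) => /negP/negPn.
apply/matrixP=> i j; rewrite mxE.
have := q0 (delta_mx 0 i + delta_mx 0 j).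
rewrite linearD /= !mulmxDl !mulmxDr !q0 add0r addr0 => e.
have tr : delta_mx 0 j *m G *m (delta_mx 0 i)^T = delta_mx 0 i *m G *m (delta_mx 0 j)^T :> 'M[F]_1.
  by rewrite [LHS]mx11_scalar -tr_scalar_mx -mx11_scalar !trmx_mul trmxK G_sym mulmxA.
move: e; rewrite tr -!mulmxA -rowE !trmx_delta -!colE => /matrixP/(_ 0 0).
rewrite !mxE -mulr2n -mulr_natl => /eqP.
by rewrite mulf_eq0 (negPf two_neq0) => /eqP.
Qed.

(** By induction on [r]: an anisotropic combination [x = a X] is sent to [y = a Y] by some [H1],
    then the orthogonal complement of [x] in the span of [X] is treated by induction after applying
    [H1]. The last clause makes the second isometry fix [y], so that it does not undo the first. *)
Lemma witt_nondegenerate r (X Y : 'M_(r, n)) :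
  X *m B *m X^T = Y *m B *m Y^T -> X *m B *m X^T \in unitmx ->
  exists H, [/\ orthogonal_mx H, X *m H = Y &
    forall z, z *m B *m X^T = 0 -> z *m B *m Y^T = 0 -> z *m H = z].
Proof.
have [N le_rN] := ubnP r; elim: N r le_rN X Y => // N IHN [|r] le_rN X Y gramXY.
  move=> _; exists 1%:M; split=> [||z]; rewrite ?mulmx1 //.
    by rewrite /orthogonal_mx mul1mx trmx1 mulmx1.
  by apply/matrixP=> -[].
set G := X *m B *m X^T => G_unit.
have G_sym : G^T = G by rewrite gram_tr.
have defG : G = X *m B *m X^T by []; move: gramXY; rewrite -defG => gramXY; clearbody G.
have [|a qa] := exists_anisotropic G_sym.
  by apply: contraTneq G_unit => ->; rewrite unitmxE det0 unitr0.
pose x := a *m X; pose y := a *m Y.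
have dotxx : (dot x x)%:M = a *m G *m a^T by rewrite -dotE trmx_mul defG !mulmxA.
have dotyy : dot x x = dot y y.
  have dotyyG : (dot y y)%:M = a *m G *m a^T by rewrite -dotE trmx_mul gramXY !mulmxA.
  by have /matrixP/(_ 0 0) := etrans dotxx (esym dotyyG); rewrite !mxE !mulr1n.
have qx : dot x x != 0.
  by apply: contra_neq qa => q0; rewrite -dotxx q0 -scalemx1 scale0r.
have [H1 [H1B xH1 H1fix]] := anisotropic_transport dotyy qx.
(* The rows of [A] are a basis of the coefficient vectors [G]-orthogonal to [a]. They number less
   than [r.+1], since [G a^T] is nonzero. *)
pose K := kermx (G *m a^T); pose A := row_base K.
have eqAK : (A :=: K)%MS := eq_row_base K.
have freeA : row_free A := row_base_free K; clearbody A.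
have AGa : A *m G *m a^T = 0.
  by rewrite -mulmxA; apply/sub_kermxP; rewrite eqAK.
have aGA : a *m G *m A^T = 0.
  by apply: trmx_inj; rewrite !trmx_mul trmxK G_sym mulmxA AGa trmx0.
have decomp (P : 'M_r.+1) : exists E D, P = D *m a + E *m A.
  (* Coefficients of the orthogonal projection on the line of [a]. *)
  pose D := (dot x x)^-1 *: (P *m G *m a^T).
  have : (P - D *m a <= A)%MS.
    rewrite eqAK; apply/sub_kermxP.
    rewrite mulmxBl !mulmxA -(mulmxA D) -(mulmxA D) -!(mulmxA a) (mulmxA a) -dotxx.
    by rewrite -scalemxAl mul_mx_scalar scalerA mulVf // scale1r subrr.
  by case/submxP => E eqE; exists E, D; rewrite -eqE addrC subrK.
have rankA : (\rank K < N)%N.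
  rewrite mxrank_ker -ltnS (leq_trans _ le_rN) // ltnS -subn_gt0 subKn ?rank_leq_row //.
  rewrite lt0n mxrank_eq0; apply: contra_neq qa; rewrite -mulmxA => ->; exact: mulmx0.
have gramA : (A *m X *m H1) *m B *m (A *m X *m H1)^T = A *m G *m A^T.
  by rewrite gram_orthogonal // !trmx_mul defG !mulmxA.
have [||H2 [H2B AH2 H2fix]] := IHN _ rankA (A *m X *m H1) (A *m Y).
- by rewrite gramA gramXY !trmx_mul !mulmxA.
(* The form stays nondegenerate on the complement: a vector of it orthogonal to [A] is also
   orthogonal to [a], hence to everything, and [G] is invertible. *)
- rewrite gramA -row_free_unit -kermx_eq0; apply/eqP.
  set c := kermx _; have cker : c *m (A *m G *m A^T) = 0 := mulmx_ker _.
  have [E [D decP]] := decomp 1%:M.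
  have cAGa : c *m A *m G *m a^T = 0 by rewrite -!(mulmxA c) AGa mulmx0.
  have cAGA : c *m A *m G *m A^T = 0 by rewrite -!(mulmxA c).
  have cAG : c *m A *m G = 0.
    rewrite -[LHS]mulmx1 -trmx1 decP linearD /= !trmx_mul mulmxDr !mulmxA.
    by rewrite cAGa cAGA !mul0mx addr0.
  have cA : c *m A = 0 by rewrite -[LHS](mulmxK G_unit) cAG mul0mx.
  by apply/eqP; rewrite -(mulmx_free_eq0 c freeA) cA.
have xyfix : y *m H2 = y.
  apply: H2fix.
    rewrite -xH1 gram_orthogonal // /x trmx_mul.
    by rewrite -aGA defG !mulmxA.
  by rewrite /y trmx_mul -aGA gramXY !mulmxA.
exists (H1 *m H2); split=> [||z zX zY].
- exact: orthogonal_mxM.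
- have [E [D decP]] := decomp 1%:M.
  rewrite -[X]mul1mx -[Y in RHS]mul1mx decP !mulmxDl; congr (_ + _).
    by rewrite -!mulmxA; congr (_ *m _); rewrite !mulmxA -/x xH1 xyfix.
  by rewrite -!mulmxA; congr (_ *m _); rewrite !mulmxA AH2.
have zH1 : z *m H1 = z.
  by apply: H1fix; rewrite /dot trmx_mul mulmxA ?zX ?zY mul0mx mxE.
rewrite mulmxA zH1; apply: H2fix.
  by rewrite -{1}zH1 gram_orthogonal // trmx_mul mulmxA zX mul0mx.
by rewrite trmx_mul mulmxA zY mul0mx.
Qed.

Lemma row_free_dual r (X : 'M_(r, n)) (m : 'rV_r) : B \in unitmx ->
  row_free X -> exists u : 'rV_n, u *m B *m X^T = m.
Proof.
move=> B_unit /row_freeP[D XD]; exists (m *m (invmx B *m D)^T).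
rewrite -(mulmxA m) -{2}B_sym -trmx_mul -(mulmxA m) -trmx_mul !mulmxA.
by rewrite mulmxK // XD trmx1 mulmx1.
Qed.

(** The radical vector [a X] is orthogonal to all rows of [X] but pairs to 1 with [u], so [u] is not
    in their span. *)
Lemma row_free_col_mx_dual r (X : 'M_(r, n)) (a m : 'rV_r) (u : 'rV_n) :
    row_free X -> a *m (X *m B *m X^T) = 0 -> u *m B *m X^T = m ->
  m *m a^T = 1%:M -> row_free (col_mx X u).
Proof.
move=> freeX aG uX ma; rewrite -kermx_eq0; apply/rowV0P => c /sub_kermxP.
rewrite -(hsubmxK c) mul_row_col => c0.
have Ga : X *m B *m X^T *m a^T = 0.
  by apply: trmx_inj; rewrite trmx_mul trmxK gram_tr aG trmx0.
have c2 : rsubmx c = 0.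
  have := congr1 (fun z => z *m B *m X^T *m a^T) c0.
  rewrite !mulmxDl !mul0mx -!mulmxA (mulmxA u) (mulmxA (u *m B)) uX ma mulmx1.
  by rewrite (mulmxA X) (mulmxA (X *m B)) Ga mulmx0 add0r.
move: c0; rewrite c2 mul0mx addr0 => /eqP; rewrite mulmx_free_eq0 // => /eqP ->.
by rewrite row_mx0.
Qed.

(* A radical vector [a *m X] of the span of [X] is given a dual partner [u], and
   [a *m Y] a dual partner [v]; adding a multiple of [a *m Y] to [v] adjusts its
   norm to that of [u]. *)
Lemma witt_extend r (X Y : 'M_(r, n)) : B \in unitmx ->
  row_free X -> row_free Y -> X *m B *m X^T = Y *m B *m Y^T ->
  X *m B *m X^T \notin unitmx ->
  exists u v : 'rV_n, [/\ row_free (col_mx X u), row_free (col_mx Y v) &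
    col_mx X u *m B *m (col_mx X u)^T = col_mx Y v *m B *m (col_mx Y v)^T].
Proof.
move=> B_unit freeX freeY gramXY.
rewrite -row_free_unit -kermx_eq0 => /rowV0Pn[a /sub_kermxP aX /rV0Pn[k ak0]].
have aY := aX; rewrite gramXY in aY.
pose m : 'rV_r := (a 0 k)^-1 *: delta_mx 0 k.
have ma : m *m a^T = 1%:M.
  rewrite -scalemxAl -rowE; apply/matrixP=> i j.
  by rewrite !mxE !ord1 mulVf.
have [u uX] := row_free_dual m B_unit freeX.
have [v uY] := row_free_dual m B_unit freeY.
pose y := a *m Y; pose s := (dot u u - dot v v) / 2%:R.
have yY : y *m B *m Y^T = 0 by rewrite /y -aY !mulmxA.
have vy : dot v y = 1 by rewrite /dot trmx_mul mulmxA uY ma mxE.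
have yy : dot y y = 0 by rewrite {1}/dot trmx_mul mulmxA yY mul0mx mxE.
have vY : (v + s *: y) *m B *m Y^T = m.
  by rewrite !mulmxDl -!scalemxAl yY scaler0 addr0.
exists u, (v + s *: y); split.
- exact: row_free_col_mx_dual aX uX ma.
- exact: row_free_col_mx_dual aY vY ma.
rewrite !tr_col_mx (mul_col_mx X) (mul_col_mx Y) !mul_col_row uX vY gramXY; congr block_mx.
  by apply: trmx_inj; rewrite (gram_tr X) (gram_tr Y) uX vY.
rewrite !dotE; congr (_%:M); rewrite !dot_simp vy (dotC y v) vy yy /s.
by field.
Qed.

(** While the common Gram matrix is singular, [witt_extend] adds one vector to each family. This
    stops because a free family has at most [n] vectors, whence the induction on [n - r]. *)
Theorem witt r (X Y : 'M_(r, n)) : B \in unitmx ->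
  row_free X -> row_free Y -> X *m B *m X^T = Y *m B *m Y^T ->
  exists2 H, orthogonal_mx H & X *m H = Y.
Proof.
move=> B_unit.
have [N le_rN] := ubnP (n - r)%N; elim: N r le_rN X Y => // N IHN r le_rN X Y.
move=> freeX freeY gramXY.
have [Gu|Gnu] := boolP (X *m B *m X^T \in unitmx).
  by have [H [HB XH _]] := witt_nondegenerate gramXY Gu; exists H.
have [u [v [freeXu freeYv gramuv]]] := witt_extend B_unit freeX freeY gramXY Gnu.
have [|H HB eqH] := IHN _ _ _ _ freeXu freeYv gramuv.
  have := freeXu; rewrite /row_free => /eqP e.
  by have := rank_leq_col (col_mx X u); rewrite e; move: le_rN; lia.
by exists H => //; move: eqH; rewrite mul_col_mx => /eq_col_mx[].
Qed.
End Witt.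

(** * Lifting isometries from F to F[[t]] *)

Section GramAlgebra.
Variable R : comNzRingType.

Lemma gram_mulr r s n (X : 'M[R]_(r, n)) (Y : 'M_(s, n)) (H B : 'M_n) :
  (X *m H) *m B *m (Y *m H)^T = X *m (H *m B *m H^T) *m Y^T.
Proof. by rewrite trmx_mul !mulmxA. Qed.

Lemma gram_mull r s n (A : 'M[R]_(s, r)) (X : 'M_(r, n)) (B : 'M_n) :
  (A *m X) *m B *m (A *m X)^T = A *m (X *m B *m X^T) *m A^T.
Proof. by rewrite trmx_mul !mulmxA. Qed.

Lemma gram_sym r n (X : 'M[R]_(r, n)) (B : 'M_n) :
  B^T = B -> (X *m B *m X^T)^T = X *m B *m X^T.
Proof. by move=> B_sym; rewrite !trmx_mul trmxK B_sym mulmxA. Qed.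

Lemma gramB n (W1 W2 C : 'M[R]_n) :
  W1 *m C *m W1^T - W2 *m C *m W2^T =
    (W1 - W2) *m C *m W1^T + W2 *m C *m (W1 - W2)^T.
Proof. by rewrite linearB mulmxBr !mulmxBl addrA subrK. Qed.

Lemma gram_add_col r k n (X Y : 'M[R]_(r, n)) (K : 'M_(k, n)) (B : 'M_n) i j :
  (col_mx X K *m B *m (col_mx X K)^T - col_mx Y K *m B *m (col_mx Y K)^T)
    (lshift k i) (lshift k j) = (X *m B *m X^T - Y *m B *m Y^T) i j.
Proof.
rewrite !tr_col_mx (mul_col_mx X) (mul_col_mx Y) !mul_col_row.
by rewrite opp_block_mx add_block_mx block_mxEul.
Qed.

(** [M] is chosen so that [M B Y^T = 1]: replacing [Y] by [Y + W M] then changes its Gram matrix by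
    [W + W^T + W (M B M^T) W^T]. The equation on [W] thus gives [Y + W M] the Gram matrix of [X],
    and the change of basis between them is an isometry. *)
Lemma gram_change n (X Xi Y Yi B Bi W : 'M[R]_n) (M := Yi^T *m Bi) :
    B^T = B -> Bi *m B = 1%:M -> Xi *m X = 1%:M -> Y *m Yi = 1%:M ->
    W + W^T + W *m (M *m B *m M^T) *m W^T = X *m B *m X^T - Y *m B *m Y^T ->
  (Xi *m (Y + W *m M)) *m B *m (Xi *m (Y + W *m M))^T = B.
Proof.
move=> B_sym BiB XiX YYi.
have MBY : M *m B *m Y^T = 1%:M.
  by rewrite -(mulmxA Yi^T) BiB mulmx1 -trmx_mul YYi trmx1.
clearbody M => eqW.
have ZBY : W *m M *m B *m Y^T = W by rewrite -!(mulmxA W) MBY mulmx1.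
have YBZ : Y *m B *m (W *m M)^T = W^T.
  by rewrite -[in RHS]ZBY [in RHS]trmx_mul [in RHS]trmx_mul trmxK B_sym mulmxA.
have gramY' : (Y + W *m M) *m B *m (Y + W *m M)^T = X *m B *m X^T.
  rewrite linearD /= !mulmxDl !mulmxDr YBZ ZBY gram_mull.
  by rewrite addrACA -addrA (addrA W) eqW addrC subrK.
by rewrite gram_mull gramY' -gram_mull XiX trmx1 mul1mx mulmx1.
Qed.

End GramAlgebra.

Section GramLifting.
Variable F : fieldType.
Hypothesis two_neq0 : (2%:R : F) != 0.
Local Notation R := {fps F}.
Local Notation X1 := (fps_Xn F 1).
Local Notation cst := (map_mx (@fps_const F)).
Local Notation red := (map_mx (@coef0 F)).

Lemma cstK m n (A : 'M[F]_(m, n)) : red (cst A) = A.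
Proof. by apply/matrixP=> i j; rewrite !mxE fps_constK. Qed.

Lemma X1Z_inj m n : injective (fun A : 'M[R]_(m, n) => X1 *: A).
Proof.
move=> A C eqAC; apply/matrixP=> i j; apply/funext=> k.
have /matrixP/(_ i j) := eqAC; rewrite !mxE => /(congr1 (fun a : R => a k.+1)).
by rewrite !fps_XnM subn1.
Qed.

(* A right inverse of [W |-> W + W^T] on symmetric matrices; an entry divisible by
   [t ^ min (d i, d j)] is put in the row where this power is the required one. *)
Definition half_part n (d : 'I_n -> nat) (E : 'M[R]_n) : 'M[R]_n :=
  \matrix_(i, j) (fps_const (if (d i < d j)%N then 1 else
                             if d i == d j then 2%:R^-1 else 0) * E i j).

Lemma half_part_sym n (d : 'I_n -> nat) (E : 'M[R]_n) :
  E^T = E -> half_part d E + (half_part d E)^T = E.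
Proof.
move=> symE; apply/matrixP=> i j; rewrite !mxE.
have -> : E j i = E i j by rewrite -{1}symE mxE.
rewrite -mulrDl -rmorphD /=.
suff -> : forall x y : nat, (if (x < y)%N then 1 else if x == y then 2%:R^-1 else 0) +
    (if (y < x)%N then 1 else if y == x then 2%:R^-1 else 0) = 1 :> F.
  by rewrite rmorph1 mul1r.
move=> x y; case: ltngtP => _; rewrite ?addr0 ?add0r //.
by rewrite -mulr2n -[_ *+ 2]mulr_natl mulfV.
Qed.

Lemma half_partB n (d : 'I_n -> nat) (E E' : 'M[R]_n) :
  half_part d (E - E') = half_part d E - half_part d E'.
Proof. by apply/matrixP=> i j; rewrite !mxE mulrBr. Qed.

(** Since all [d i] are positive, [E = t E1]. Substituting [t W] for the unknown turns the equation
    into [W + W^T = E1 - t W C W^T]; the factor [t] makes its solution by [half_part] a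
    contraction. *)
Lemma gram_correction n (d : 'I_n -> nat) (E C : 'M[R]_n) :
    (forall i, 0 < d i)%N -> E^T = E -> C^T = C ->
    (forall i j, low (minn (d i) (d j)) (E i j)) ->
  exists W, W + W^T + W *m C *m W^T = E /\ forall i j, low (d i) (W i j).
Proof.
move=> d_gt0 symE symC lowE.
have [|E1 defE] := @lowmx1P _ _ _ E.
  apply/matrixP=> i j; rewrite !mxE; apply: (lowE i j).
  by rewrite leq_min !d_gt0.
have symE1 : E1^T = E1.
  by apply: X1Z_inj; rewrite /= -linearZ /= -defE symE.
pose Q (W : 'M[R]_n) := W *m C *m W^T.
have symQ W : (Q W)^T = Q W by rewrite gram_sym.
pose Phi W := half_part d (E1 - X1 *: Q W).
have [W PhiW] : exists W, Phi W = W.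
  apply: contraction_fixpoint => k W1 W2 lowW12.
  rewrite -half_partB => i j; rewrite mxE; apply: lowMl.
  have -> : E1 - X1 *: Q W1 - (E1 - X1 *: Q W2) = - (X1 *: (Q W1 - Q W2)).
    by rewrite scalerBr !opprB addrC addrA subrK.
  have -> : Q W1 - Q W2 = (W1 - W2) *m C *m W1^T + W2 *m C *m (W1 - W2)^T.
    exact: gramB.
  apply: lowmxN; apply: (@lowmx_XnZ _ _ _ k 1); apply: lowmxD.
    by apply/lowmxMr/lowmxMr.
  by apply/lowmxMl/lowmx_tr.
(* The bound is shifted by one because the solution is [t W]. If [d j < d i], [half_part] puts 0 at
   [(i, j)]. Otherwise [E1] has the required order there, and the quadratic term, a multiple of [t]
   and of entries of row [i] of [W], is handled by induction on [k]. *)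
have lowW k i j : (k.+1 < d i)%N -> W i j k = 0.
  elim/ltn_ind: k i j => k IHk i j lt_kd; rewrite -PhiW mxE.
  have [lt_ji|le_ij] := ltnP (d j) (d i).
    by rewrite ltnNge (ltnW lt_ji) gtn_eqF //= rmorph0 mul0r.
  suff lowEQ : low k.+1 ((E1 - X1 *: Q W) i j) by exact: (lowMl _ lowEQ (ltnSn k)).
  rewrite !mxE; apply: lowB => [m le_mk|].
    have := lowE i j m.+1; rewrite defE mxE fps_XnM subn1; apply.
    by rewrite (minn_idPl le_ij); apply: leq_ltn_trans lt_kd.
  apply: (@low_XnM _ 1); apply: low_sum => l; apply: lowMr.
  rewrite mxE; apply: low_sum => p; apply: lowMr => m lt_mk.
  by apply: IHk => //; lia.
have sumW : W + W^T = E1 - X1 *: Q W.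
  by rewrite -{1 2}PhiW half_part_sym // linearB linearZ /= symQ symE1.
exists (X1 *: W); split.
  rewrite defE -(subrK (X1 *: Q W) E1) -sumW !scalerDr linearZ /=.
  by rewrite -!scalemxAl -scalemxAr.
move=> i j [|k] lt_kd; rewrite mxE fps_XnM //= subn1; exact: lowW.
Qed.


Variables (n : nat) (B : 'M[F]_n).
Hypotheses (B_sym : B^T = B) (B_unit : B \in unitmx).

(** For [H = X^-1 (Y + W M)] the error [X H - Y] is [W M], so the divisibility of row [i] of [W] by
    [t ^ (d i)] passes to it. *)
Lemma lift_basis (d : 'I_n -> nat) (X Y : 'M[R]_n) :
    (forall i, 0 < d i)%N -> red X \in unitmx -> red Y \in unitmx ->
    (forall i j, low (minn (d i) (d j))
       ((X *m cst B *m X^T - Y *m cst B *m Y^T) i j)) ->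
  exists H : 'M[R]_n, H *m cst B *m H^T = cst B /\
    forall i j, low (d i) ((X *m H - Y) i j).
Proof.
move=> d_gt0 /fps_mx_inverse[Xi [XXi XiX]] /fps_mx_inverse[Yi [YYi YiY]].
set E := _ - _ => lowE.
have csymB : (cst B)^T = cst B by rewrite matrix.map_trmx B_sym.
have symE : E^T = E by rewrite linearB /= !gram_sym.
pose M := Yi^T *m cst (invmx B).
have symC : (M *m cst B *m M^T)^T = M *m cst B *m M^T by rewrite gram_sym.
have [W [eqW lowW]] := gram_correction d_gt0 symE symC lowE.
exists (Xi *m (Y + W *m M)); split.
  by apply: gram_change eqW => //; rewrite -map_mxM mulVmx // map_mx1.
move=> i j; rewrite mulmxA XXi mul1mx addrC addKr mxE.
by apply: low_sum => k; apply: lowMr.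
Qed.

End GramLifting.

Lemma complete_basis (F : fieldType) r k (A : 'M[F]_(r, r + k)) :
  row_free A -> exists K : 'M_(k, r + k), col_mx A K \in unitmx.
Proof.
move=> /eqP rankA.
have rankC : \rank (A^C)%MS = k by rewrite mxrank_compl rankA addKn.
have [K eqK] : exists K : 'M_(k, r + k), (K :=: A^C)%MS.
  by move: (row_base _) (eq_row_base A^C%MS); rewrite rankC => K eqK; exists K.
exists K; rewrite -row_full_unit -sub1mx.
by rewrite -addsmxE (adds_eqmx (eqmx_refl A) eqK) sub1mx addsmx_compl_full.
Qed.

Section OrthogonalLifting.
Variable F : fieldType.
Hypothesis two_neq0 : (2%:R : F) != 0.
Local Notation R := {fps F}.
Local Notation cst := (map_mx (@fps_const F)).
Local Notation red := (map_mx (@coef0 F)).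

Lemma lift_same_reduction n (B : 'M[F]_n) r (d : 'I_r -> nat) (X Y : 'M[R]_(r, n)) :
    B^T = B -> B \in unitmx -> (forall i, 0 < d i)%N ->
    row_free (red X) -> red X = red Y ->
    (forall i j, low (minn (d i) (d j))
       ((X *m cst B *m X^T - Y *m cst B *m Y^T) i j)) ->
  exists H : 'M[R]_n, H *m cst B *m H^T = cst B /\
    forall i j, low (d i) ((X *m H - Y) i j).
Proof.
move=> B_sym B_unit d_gt0 freeX eqXY.
have [k defn] : exists k, (n = r + k)%N.
  by exists (n - r)%N; rewrite subnKC // -(eqP freeX) rank_leq_col.
subst n => lowXY; have [K K_unit] := complete_basis freeX.
pose d' (i : 'I_(r + k)) := if split i is inl j then d j else 1%N.
pose X' := col_mx X (cst K); pose Y' := col_mx Y (cst K).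
have redX' : red X' = col_mx (red X) K by rewrite map_col_mx cstK.
have redY' : red Y' = red X' by rewrite redX' map_col_mx cstK eqXY.
have X'_unit : red X' \in unitmx by rewrite redX'.
have [|||i j|H [HB lowH]] := lift_basis two_neq0 B_sym B_unit (d := d') (X := X') (Y := Y').
- by move=> i; rewrite /d'; case: split.
- exact: X'_unit.
- by rewrite redY'.
(* An entry involving an added row has to vanish only modulo [t], since [d'] is 1 there; this
   follows from the equality of the reductions. *)
- have low1 : low 1 ((X' *m cst B *m X'^T - Y' *m cst B *m Y'^T) i j).
    case=> // _; rewrite -/(coef0 _).
    have : red (X' *m cst B *m X'^T - Y' *m cst B *m Y'^T) = 0.
      by rewrite map_mxB !map_mxM -!matrix.map_trmx redY' subrr.
    by move/matrixP/(_ i j); rewrite mxE [RHS]mxE.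
  rewrite /d'; case: (splitP i) => i' eqi; last by apply: lowW low1; lia.
  case: (splitP j) => j' eqj; last by apply: lowW low1; lia.
  have -> : i = lshift k i' by apply: val_inj.
  have -> : j = lshift k j' by apply: val_inj.
  by rewrite gram_add_col; apply: lowXY.
exists H; split=> // i j; have := lowH (lshift k i) j.
rewrite /d' (unsplitK (inl i : 'I_r + 'I_k)) mul_col_mx opp_col_mx add_col_mx.
by rewrite col_mxEu.
Qed.

(** The Gram matrices agree modulo [t], so Witt's theorem gives an isometry [H0] between the
    reductions. Seen as a constant matrix it preserves the form over the power series, and [X H0]
    and [Y] have the same reduction. *)
Theorem lift_orthogonal n (B : 'M[F]_n) r (d : 'I_r -> nat) (X Y : 'M[R]_(r, n)) :
    B^T = B -> B \in unitmx -> (forall i, 0 < d i)%N ->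
    row_free (red X) -> row_free (red Y) ->
    (forall i j, low (minn (d i) (d j))
       ((X *m cst B *m X^T - Y *m cst B *m Y^T) i j)) ->
  exists H : 'M[R]_n, H *m cst B *m H^T = cst B /\
    forall i j, low (d i) ((X *m H - Y) i j).
Proof.
move=> B_sym B_unit d_gt0 freeX freeY lowXY.
have gram0 : red X *m B *m (red X)^T = red Y *m B *m (red Y)^T.
  have : red (X *m cst B *m X^T - Y *m cst B *m Y^T) = 0.
    apply/matrixP=> i j; rewrite mxE [RHS]mxE; apply: lowXY.
    by rewrite leq_min !d_gt0.
  by rewrite map_mxB !map_mxM cstK -!matrix.map_trmx => /eqP; rewrite subr_eq0 => /eqP.
have [H0 H0B XH0] := witt two_neq0 B_sym B_unit freeX freeY gram0.
have H0B' : cst H0 *m cst B *m (cst H0)^T = cst B.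
  by rewrite matrix.map_trmx -!map_mxM H0B.
have redXH0 : red (X *m cst H0) = red Y by rewrite map_mxM cstK.
have [||i j|H1 [H1B XH1]] := lift_same_reduction B_sym B_unit d_gt0 (X := X *m cst H0) (Y := Y).
- by rewrite redXH0.
- exact: redXH0.
- by rewrite gram_mulr H0B'.
exists (cst H0 *m H1); split; last by move=> i j; rewrite mulmxA.
by rewrite (gram_mull (cst H0) H1) H1B.
Qed.
End OrthogonalLifting.

(** * Elementary divisors *)

Section ElementaryDivisors.
Variables (F : fieldType) (S : lmodType {fps F}).
Local Notation R := {fps F}.
Local Notation Xn := (fps_Xn F).

Definition spans r (s : 'I_r -> S) : Prop :=
  forall u, exists a : 'I_r -> R, u = \sum_i a i *: s i.

Definition killed_by r (d : 'I_r -> nat) (s : 'I_r -> S) : Prop :=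
  forall i, Xn (d i) *: s i = 0.

(** With [spans] and [killed_by], this identifies [S] with the direct sum of the [F[[t]] / (t ^ (d
    i))]. *)
Definition independent_mod r (d : 'I_r -> nat) (s : 'I_r -> S) : Prop :=
  forall a : 'I_r -> R, \sum_i a i *: s i = 0 -> forall i, low (d i) (a i).

Lemma low_killed m (a : R) (u : S) : low m a -> Xn m *: u = 0 -> a *: u = 0.
Proof. by move=> /lowP[c ->] u0; rewrite mulrC -scalerA u0 scaler0. Qed.

Lemma spans_drop r (s : 'I_r.+1 -> S) (i0 : 'I_r.+1) :
  s i0 = 0 -> spans s -> spans (fun i => s (lift i0 i)).
Proof.
move=> s0 gen u; have [a ->] := gen u; exists (fun i => a (lift i0 i)).
by rewrite (bigD1_ord i0) //= s0 scaler0 add0r.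
Qed.

Lemma spans_replace r (s : 'I_r -> S) (k : 'I_r -> R) (i0 : 'I_r) :
    k i0 0%N != 0 -> spans s ->
  spans (fun i => if i == i0 then \sum_j k j *: s j else s i).
Proof.
move=> /fps_inverse[h kh] gen u; have [a ->] := gen u.
(* Solve for [s i0] in terms of the new generator, [h] being the inverse of [k i0], and
   substitute. *)
exists (fun i => if i == i0 then a i0 * h else a i - a i0 * h * k i).
rewrite [RHS](bigD1 i0) //= !eqxx [in RHS](bigD1 i0) //= [LHS](bigD1 i0) //=.
rewrite scalerDr scalerA mulrAC -mulrA kh mulr1 -addrA; congr (_ + _).
rewrite scaler_sumr -big_split; apply: eq_bigr => i /negPf -> /=.
by rewrite scalerA scalerBl addrC subrK.
Qed.

(* A relation among the generators that is not a consequence of the relations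
   [t ^ (d i) s_i = 0] can be divided by the least power of [t] it involves; this
   gives a generator of smaller order, so that [\sum_i (d i).+1] decreases. *)
Lemma elementary_divisors r (s : 'I_r -> S) (d : 'I_r -> nat) :
    spans s -> killed_by d s ->
  exists r' (s' : 'I_r' -> S) (d' : 'I_r' -> nat),
    [/\ forall i, (0 < d' i)%N, killed_by d' s', spans s' & independent_mod d' s'].
Proof.
have [m] := ubnP (\sum_i (d i).+1); elim: m r s d => // m IHm r s d le_dm gen kil.
(* A generator with [d i = 0] is zero and is dropped; the successor in the measure makes this a
   decrease. *)
have [/existsP[i0 /eqP d0]|d_gt0] := boolP [exists i, d i == 0%N].
  case: r => [|r] in s d i0 d0 gen kil le_dm *; first by case: i0 d0.
  have s0 : s i0 = 0 by rewrite -(kil i0) d0 scale1r.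
  apply: (IHm _ (fun i => s (lift i0 i)) (fun i => d (lift i0 i))).
  - by move: le_dm; rewrite (bigD1_ord i0) //=; lia.
  - exact: spans_drop.
  - by move=> i; apply: kil.
have {}d_gt0 i : (0 < d i)%N.
  by rewrite lt0n; apply: contra d_gt0 => di; apply/existsP; exists i.
have [|/existsNP[a /not_implyP[sa0 /existsNP[i1 /existsNP[e1 /not_implyP[lt_e1 ae1]]]]]] :=
  pselect (independent_mod d s); first by exists r, s, d.
pose P e := [exists i, (e < d i)%N && (a i e != 0)].
have exP : exists e, P e.
  by exists e1; apply/existsP; exists i1; rewrite lt_e1; apply/eqP.
case: (ex_minnP exP) => e /existsP[i0 /andP[lt_e ae]] min_e {exP i1 e1 lt_e1 ae1}.
have lowa i k : (k < e)%N -> (k < d i)%N -> a i k = 0.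
  move=> lt_ke lt_kd; apply/eqP; apply: contraLR lt_ke => aik; rewrite -leqNgt.
  by apply: min_e; apply/existsP; exists i; rewrite lt_kd.
(* The quotient of [a i] by [t ^ e], up to terms killing [s i]. When [d i <= e], minimality of [e]
   gives [a i s_i = 0], so 0 can be used. The constant term of [k i0] is nonzero. *)
pose k i : R := if (d i <= e)%N then 0 else ((fun n => a i (n + e)%N) : R).
have ak i : a i *: s i = Xn e *: (k i *: s i).
  rewrite /k; case: leqP => [le_de|lt_ed].
    rewrite scale0r scaler0; apply: low_killed (kil i) => n lt_nd.
    by apply: lowa; rewrite // (leq_trans lt_nd).
  rewrite scalerA; congr (_ *: _); apply/funext=> n; rewrite fps_XnM.
  by case: leqP => [/subnK ->|lt_ne] //; apply: lowa => //; apply: ltn_trans lt_ed.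
apply: (IHm _ (fun i => if i == i0 then \sum_j k j *: s j else s i)
              (fun i => if i == i0 then e else d i)).
- have -> : (\sum_i (if i == i0 then e else d i).+1 =
      e.+1 + \sum_(i | i != i0) (d i).+1)%N.
    by rewrite (bigD1 i0) //= eqxx; congr addn; apply: eq_bigr => i /negPf ->.
  by move: le_dm; rewrite (bigD1 i0) //=; lia.
- by apply: spans_replace => //; rewrite /k leqNgt lt_e.
- move=> i; case: eqP => _; last exact: kil.
  by rewrite scaler_sumr -(eq_bigr _ (fun i _ => ak i)).
Qed.

End ElementaryDivisors.

(** * Tensors over F[[t]] *)

Section TensorSpan.
Variables (R : comNzRingType) (S L : lmodType R).

Lemma tens_suml (I : finType) (f : I -> S) (v : L) :
  (\sum_i f i) *t v = \sum_i f i *t v.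
Proof. exact: (big_morph (fun u => u *t v) (tensDl v) (tens0l S v)). Qed.

Lemma tensBr (u : S) (v w : L) : u *t (v - w) = u *t v - u *t w.
Proof. by rewrite tensDr -scaleN1r tensZr scaleN1r. Qed.

End TensorSpan.

(** * Coordinates on [V[[t]]] *)

Section DualBasis.
Variables (F : fieldType) (V : vectType F) (b : {symmetric V}).
Hypothesis nondeg : nondegenerate b.
Local Notation R := {fps F}.
Local Notation cst := (map_mx (@fps_const F)).

(** Any dual family [f], [f'] represents the [i]-th coordinate form of a basis as pairing with
    [\sum_k coord_i (f k) f' k]; this adds biorthogonality to the expansion. *)
Lemma dual_basis : exists n (e e' : 'I_n -> V),
  (forall v, v = \sum_k b v (e' k) *: e k) /\
  (forall j k, b (e j) (e' k) = (j == k)%:R).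
Proof.
have [m [f [f' ff']]] := nondegenerate_dual nondeg.
pose X := vbasis {:V}; exists (\dim {:V}), (fun i => X`_i).
exists (fun i => \sum_k coord X i (f k) *: f' k).
have coordE v i : b v (\sum_k coord X i (f k) *: f' k) = coord X i v.
  rewrite linear_sumr [in RHS](ff' v) linear_sum; apply: eq_bigr => k _.
  by rewrite linearZr_LR linearZ /= mulrC.
split=> [v|j k]; last by rewrite coordE coord_free // (basis_free (vbasisP _)).
by under eq_bigr do rewrite coordE; rewrite -coord_vbasis ?memvf.
Qed.

(* The Gram matrix has its coefficients in [F], which makes Witt's theorem over
   [F] applicable modulo [t]. *)
Lemma series_coordinates : exists n (B : 'M[F]_n)
    (crd : V[[t]] -> 'rV[R]_n) (vec : 'rV[R]_n -> V[[t]]),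
  [/\ B^T = B, B \in unitmx, linear crd, cancel crd vec & cancel vec crd] /\
  forall z w, (series_form b z w)%:M = crd z *m cst B *m (crd w)^T.
Proof.
have [n [e [e' [ee' dual]]]] := dual_basis.
pose B : 'M[F]_n := \matrix_(i, j) b (e i) (e j).
pose E k : V[[t]] := stens (e k) 1; pose E' k : V[[t]] := stens (e' k) 1.
pose crd (z : V[[t]]) : 'rV[R]_n := \row_k series_form b z (E' k).
pose vec (a : 'rV[R]_n) : V[[t]] := \sum_k a 0 k *: E k.
have vec_lin : linear vec.
  move=> a u w; rewrite /vec scaler_sumr -big_split; apply: eq_bigr => k _ /=.
  by rewrite !mxE scalerDl scalerA.
have crd_lin : linear crd.
  by move=> a z w; apply/rowP=> k; rewrite !mxE linearPl.
have crdK : cancel crd vec.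
  pose h z := vec (crd z).
  have hD z w : h (z + w) = h z + h w.
    by have := crd_lin 1 z w; have := vec_lin 1 (crd z) (crd w); rewrite /h !scale1r => <- ->.
  suff : forall z : tensor V R, h z = z by [].
  elim/tensor_ind=> [|v c|z w IHz IHw].
  - by apply: (addrI (h 0)); rewrite -hD !addr0.
  - rewrite [v in RHS]ee' (tens_suml _ c); apply: eq_bigr => k _.
    rewrite mxE -stensE (series_form_tens b v c) mulr1.
    by rewrite /stens tensZr tensZl.
  by rewrite -{2}IHz -{2}IHw; apply: hD.
have vecK : cancel vec crd.
  move=> a; apply/rowP=> j; rewrite mxE /vec linear_sumlz (bigD1 j) //= big1.
    by rewrite addr0 linearZl_LR /= series_form_tens dual eqxx scale1r !mulr1.
  move=> k /negPf nekj.
  by rewrite linearZl_LR /= series_form_tens dual nekj scale0r mulr0.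
exists n, B, crd, vec; split; first split=> //.
- by apply/matrixP=> i j; rewrite !mxE hermC expr0 mul1r.
(* The Gram matrix of the dual basis is the inverse of [B]. *)
- have /mulmx1_unit[] // : B *m (\matrix_(i, j) b (e' i) (e' j))^T = 1%:M.
  apply/matrixP=> i j; rewrite !mxE -[RHS]dual [in RHS](ee' (e' j)) linear_sumr.
  by apply: eq_bigr => k _; rewrite !mxE linearZr_LR /= mulrC.
move=> z w; rewrite [RHS]mx11_scalar; congr (_%:M).
rewrite -{1}(crdK z) -{1}(crdK w) /vec linear_sumlz mxE.
under eq_bigr do rewrite linear_sumr.
rewrite exchange_big; apply: eq_bigr => j _; rewrite !mxE mulr_suml.
apply: eq_bigr => i _; rewrite linearZl_LR /= linearZr_LR /= series_form_tens !mxE mulr1.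
by rewrite -fps_const_mul mulr1; ring.
Qed.
End DualBasis.

Section TensorForm.
Variables (R : comNzRingType) (S L : lmodType R).
Variable b : {symmetric L}.

Lemma form_map_tens_sum (I : finType) (s : I -> S) (v : I -> L) w :
  form_map b (\sum_i s i *t v i) w = \sum_i b (v i) w *: s i.
Proof.
have := form_map_sum b [seq (s i, v i) | i <- index_enum I] w.
by rewrite !big_map.
Qed.

Lemma quad_tensor_tens_sum (I : finType) (s : I -> S) (v : I -> L) :
  quad_tensor_val b (\sum_i s i *t v i) =
    \sum_i \sum_j b (v i) (v j) *: (s i *t s j).
Proof.
have := quad_tensor_sum b [seq (s i, v i) | i <- index_enum I].
rewrite !big_map /= => ->; apply: eq_bigr => i _; by rewrite big_map.
Qed.

Lemma orth_act_tens_sum (I : finType) (s : I -> S) (v : I -> L)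
    (g : orthogonal_group b) :
  orth_act (\sum_i s i *t v i) g = \sum_i s i *t g (v i).
Proof.
rewrite /orth_act /tmap (tlift_sum (tmap_balanced idfun g)).
by apply: eq_bigr => i _; rewrite -/(tmap _ _ _) tmap_tens.
Qed.

End TensorForm.

(** * Orbits of tensors whose associated map is surjective *)

Section TensorOrbit.
Variables (F : fieldType) (S : lmodType {fps F}).
Local Notation R := {fps F}.
Local Notation Xn := (fps_Xn F).

Lemma spans_tensor r (s : 'I_r -> S) (L : lmodType R) (x : tensor S L) :
  spans s -> exists v : 'I_r -> L, x = \sum_i s i *t v i.
Proof.
move=> gen; elim/tensor_ind: x => [|u v|x y [v ->] [w ->]].
- by exists (fun=> 0); rewrite big1 // => i _; rewrite tens0r.
- have [a ->] := gen u; exists (fun i => a i *: v).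
  by rewrite tens_suml; apply: eq_bigr => i _; rewrite tensZl tensZr.
exists (fun i => v i + w i); rewrite -big_split.
by apply: eq_bigr => i _; rewrite tensDr.
Qed.

(* The coefficients below [t ^ min(d i, d j)] of the product of the [i]-th and
   [j]-th coordinates depend bilinearly on a pair of elements of [S]. *)
Lemma tensor_independent r (s : 'I_r -> S) (d : 'I_r -> nat) (c : 'I_r -> 'I_r -> R) :
    spans s -> independent_mod d s ->
    \sum_p \sum_q c p q *: (s p *t s q) = 0 ->
  forall i j, low (minn (d i) (d j)) (c i j).
Proof.
move=> gen ind c0 i j l; rewrite leq_min => /andP[lt_li lt_lj].
(* The coordinates [al u] are arbitrary choices, but independence makes the [k]-th one unique, hence
   linear in [u], modulo [t ^ (d k)]. *)
have /choice[al alE] := gen.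
have alD k u v : low (d k) (al (u + v) k - (al u k + al v k)).
  apply: (ind (fun k => al (u + v) k - (al u k + al v k))).
  by under eq_bigr do rewrite scalerBl scalerDl; rewrite sumrB big_split -!alE subrr.
have alZ k a u : low (d k) (al (a *: u) k - a * al u k).
  apply: (ind (fun k => al (a *: u) k - a * al u k)).
  under eq_bigr do rewrite scalerBl -scalerA.
  by rewrite sumrB -scaler_sumr -!alE subrr.
have als k p : low (d k) (al (s p) k - (k == p)%:R).
  apply: (ind (fun k => al (s p) k - (k == p)%:R)).
  under eq_bigr do rewrite scalerBl.
  rewrite sumrB -alE (bigD1 p) //= eqxx scale1r big1 ?addr0 ?subrr // => q /negPf ->.
  by rewrite scale0r.
have low_coef m (a a' : R) : low m (a - a') -> (l < m)%N -> a l = a' l.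
  by move=> lowa /lowa /eqP; rewrite fpsD fpsN subr_eq0 => /eqP.
pose f u v : F := (al u i * al v j) l.
have bf : balanced f.
  split=> [v u1 u2|u v1 v2|a u v]; rewrite /f -?fpsD.
  - rewrite -mulrDl; apply: low_coef lt_li; rewrite -mulrBl; exact: lowMr.
  - rewrite -mulrDr; apply: low_coef lt_lj; rewrite -mulrBr; exact: lowMl.
  transitivity ((a * al u i * al v j) l).
    by apply: low_coef lt_li; rewrite -mulrBl; apply: lowMr.
  apply/esym; rewrite (mulrC a) -mulrA; apply: low_coef lt_lj; rewrite -mulrBr.
  exact: lowMl.
have ftens a p q : tlift f (a *: (s p *t s q)) = (a * ((i == p)%:R * (j == q)%:R)) l.
  rewrite -tensZl (tlift_tens bf) /f.
  transitivity ((a * al (s p) i * al (s q) j) l).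
    by apply: low_coef lt_li; rewrite -mulrBl; apply: lowMr.
  transitivity ((a * (i == p)%:R * al (s q) j) l).
    by apply: low_coef lt_li; rewrite -mulrBl -mulrBr; apply/lowMr/lowMl.
  by rewrite mulrA; apply: low_coef lt_lj; rewrite -mulrBr; apply: lowMl.
have := congr1 (tlift f) c0.
rewrite (tlift0 bf) (tlift_sum bf) (bigD1 i) //= (tlift_sum bf) (bigD1 j) //=.
rewrite ftens !eqxx !mulr1 !big1 ?addr0 // => [p /negPf nepi|q /negPf neqj].
  rewrite (tlift_sum bf) big1 // => q _.
  by rewrite ftens eq_sym nepi mul0r mulr0.
by rewrite ftens [j == q]eq_sym neqj !mulr0.
Qed.


Variables (V : vectType F) (b : {symmetric V}).
Hypotheses (two_neq0 : (2%:R : F) != 0) (nondeg : nondegenerate b).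
Local Notation form := (series_form b).
Local Notation cst := (map_mx (@fps_const F)).
Local Notation red := (map_mx (@coef0 F)).

(** The images under [f_x] of a finite generating family of [V[[t]]] generate [S]. *)
Lemma spans_form_im (x : tensor S V[[t]]) :
  (forall u, exists v, form_map form x v = u) ->
  exists r (s : 'I_r -> S), spans s.
Proof.
move=> surj; have [r [e [e' ee']]] := series_dual_family nondeg.
exists r, (fun k => form_map form x (e k)) => u.
have [v <-] := surj u; exists (fun k => form v (e' k)).
pose f : V[[t]] -> S := form_map form x.
pose fL := GRing.isLinear.Build R V[[t]] S *:%R f (form_map_linear _ x).
pose fl : {linear V[[t]] -> S} := HB.pack f fL.
rewrite -[LHS]/(fl v) {1}(ee' v) linear_sum; apply: eq_bigr => k _.
by rewrite linearZ.
Qed.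

(** To be applied with the common image as [S]: the two maps are then onto, and the quadratic
    tensors are compared in [S (x) S], as [T] requires. *)
Theorem same_orbit_of_quad_tensor (N : nat) (x y : tensor S V[[t]]) :
    (forall u : S, Xn N *: u = 0) ->
    (forall u, exists v, form_map form x v = u) ->
    (forall u, exists v, form_map form y v = u) ->
    quad_tensor_val form x = quad_tensor_val form y ->
  same_orbit form x y.
Proof.
move=> killN surjx surjy eqT.
have [r0 [s0 gen0]] := spans_form_im surjx.
have [r [s [d [d_gt0 kil gen ind]]]] :=
  elementary_divisors (d := fun=> N) gen0 (fun i => killN (s0 i)).
have [v defx] := spans_tensor x gen; have [w defy] := spans_tensor y gen.
have [n [B [crd [vec [[B_sym B_unit crd_lin crdK vecK] formE]]]]] := series_coordinates nondeg.
pose coords (z : 'I_r -> V[[t]]) := \matrix_(i, k) crd (z i) 0 k : 'M[R]_(r, n).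
have row_coords z i : row i (coords z) = crd (z i).
  by apply/rowP=> k; rewrite !mxE.
have gramE (z z' : 'I_r -> V[[t]]) i j :
    (coords z *m cst B *m (coords z')^T) i j = form (z i) (z' j).
  have /matrixP/(_ 0 0) := formE (z i) (z' j); rewrite !mxE mulr1n => ->.
  by apply: eq_bigr => k _; rewrite !mxE; congr (_ * _); apply: eq_bigr => l _; rewrite !mxE.
(* If [f_t] sends [u j] to [s j], independence gives [(z i, u j) = (i == j)] modulo [t ^ (d i)],
   hence modulo [t]: the [u j] provide a right inverse of the reduced coordinates. *)
have free z (t : tensor S V[[t]]) : t = \sum_i s i *t z i ->
    (forall u, exists v, form_map form t v = u) -> row_free (red (coords z)).
  move=> -> surj.
  have /choice[u uE] :
      forall i, exists u, form_map form (\sum_i s i *t z i) u = s i.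
    by move=> i; apply: surj.
  apply/row_freeP; exists (B *m (red (coords u))^T).
  rewrite matrix.map_trmx mulmxA -{1}(cstK B) -!map_mxM; apply/matrixP=> i j.
  rewrite mxE gramE !mxE.
  have lowz : low (d i) (form (z i) (u j) - (i == j)%:R).
    apply: (ind (fun i => form (z i) (u j) - (i == j)%:R)).
    under eq_bigr do rewrite scalerBl.
    rewrite sumrB -form_map_tens_sum uE (bigD1 j) //= eqxx scale1r big1 ?addr0 ?subrr //.
    by move=> k /negPf ->; rewrite scale0r.
  have := lowz 0%N (d_gt0 i); rewrite -/(coef0 _) rmorphB /= rmorph_nat => /eqP.
  by rewrite subr_eq0 => /eqP.
have [H [HB lowH]] : exists H : 'M[R]_n, H *m cst B *m H^T = cst B /\
    forall i j, low (d i) ((coords v *m H - coords w) i j).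
  apply: lift_orthogonal => //; [exact: (free v x) | exact: (free w y)|].
  move=> i j; rewrite mxE [X in _ + X]mxE !gramE.
  apply: (tensor_independent (c := fun i j => form (v i) (v j) - form (w i) (w j)) gen ind).
  move: eqT; rewrite defx defy !quad_tensor_tens_sum => /eqP; rewrite -subr_eq0 => /eqP.
  apply: etrans; rewrite -sumrB; apply: eq_bigr => p _; rewrite -sumrB.
  by apply: eq_bigr => q _; apply: scalerBl.
(* The isometry equation [H B H^T = B] exhibits the inverse [B H^T B^-1]. *)
have HHi : H *m (cst B *m H^T *m cst (invmx B)) = 1%:M.
  by rewrite !mulmxA HB -map_mxM mulmxV // map_mx1.
have HiH := mulmx1C HHi; set Hi := cst B *m _ *m _ in HHi HiH.
have vec_lin : linear vec.
  by move=> a u z; rewrite -{1}(vecK u) -{1}(vecK z) -crd_lin crdK.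
pose g z := vec (crd z *m H).
have g_lin : linear g.
  by move=> a z z'; rewrite /g crd_lin mulmxDl -scalemxAl vec_lin.
pose gL := GRing.isLinear.Build R V[[t]] V[[t]] *:%R g g_lin.
pose gl : {linear V[[t]] -> V[[t]]} := HB.pack g gL.
have g_bij : bijective gl.
  exists (fun z => vec (crd z *m Hi)) => z; rewrite [gl _]/(g _) /g vecK -mulmxA.
    by rewrite HHi mulmx1 crdK.
  by rewrite HiH mulmx1 crdK.
have g_iso : isometry form form gl.
  move=> z z'; have := formE (g z) (g z'); rewrite /g !vecK gram_mulr HB -formE.
  by move/matrixP/(_ 0 0); rewrite !mxE !mulr1n.
exists (OrthogonalGroup g_bij g_iso).
rewrite defx orth_act_tens_sum defy; apply: eq_bigr => i _ /=.
apply/eqP; rewrite -subr_eq0 -tensBr; apply/eqP.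
(* The difference of [g (v i)] and [w i] is a multiple of [t ^ (d i)]; moving this power across the
   tensor product kills [s i]. *)
have [D defD] : exists D, row i (coords v *m H - coords w) = Xn (d i) *: D.
  by apply: lowmxP => k j; rewrite mxE; apply: lowH.
have -> : g (v i) - w i = Xn (d i) *: vec D.
  have vecB a c : vec (a - c) = vec a - vec c.
    by rewrite addrC -scaleN1r vec_lin scaleN1r addrC.
  have vecZ a c : vec (a *: c) = a *: vec c.
    by rewrite -[a *: c]addr0 vec_lin -(subrr 0) vecB subrr addr0.
  by rewrite -vecZ -defD linearB /= row_mul !row_coords vecB crdK.
by rewrite tensZr -tensZl kil tens0l.
Qed.
End TensorOrbit.

(** * Orbits and images *)

Section OrthogonalAction.
Variables (R : comNzRingType) (N L : lmodType R) (b : {symmetric L}).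
Implicit Types (x y : tensor N L) (S : submodule N) (g : orthogonal_group b).

Lemma form_map_tmap_val S (z : tensor (subm S) L) v :
  form_map b (tmap val idfun z) v = val (form_map b z v).
Proof.
have bv := tmap_balanced (val : {linear subm S -> N}) (idfun : {linear L -> L}).
elim/tensor_ind: z => [|u w|z1 z2 IH1 IH2].
- by rewrite /tmap (tlift0 bv) /form_map !(tlift0 (form_map_balanced _ _ _)).
- rewrite /tmap (tlift_tens bv) /form_map !(tlift_tens (form_map_balanced _ _ _)).
  by rewrite linearZ.
rewrite /tmap (tliftD bv) /form_map !(tliftD (form_map_balanced _ _ _)).
by rewrite raddfD; congr (_ + _).
Qed.

Lemma orth_act_tmap_val S (z : tensor (subm S) L) g :
  orth_act (tmap val idfun z) g = tmap val idfun (orth_act z g).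
Proof.
have bv := tmap_balanced (val : {linear subm S -> N}) (idfun : {linear L -> L}).
have bg (P : lmodType R) := tmap_balanced (idfun : {linear P -> P}) g.
elim/tensor_ind: z => [|u w|z1 z2 IH1 IH2].
- by rewrite /orth_act /tmap (tlift0 bv) !(tlift0 (bg _)) (tlift0 bv).
- by rewrite /orth_act /tmap (tlift_tens bv) !(tlift_tens (bg _)) (tlift_tens bv).
rewrite /orth_act /tmap (tliftD bv) !(tliftD (bg _)) (tliftD bv).
by congr (_ + _).
Qed.

Lemma form_map_orth_act x g v : form_map b (orth_act x g) (g v) = form_map b x v.
Proof.
have bg := tmap_balanced (idfun : {linear N -> N}) g.
elim/tensor_ind: x => [|u w|z1 z2 IH1 IH2].
- by rewrite /orth_act /tmap (tlift0 bg) /form_map !(tlift0 (form_map_balanced _ _ _)).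
- rewrite /orth_act /tmap (tlift_tens bg) /form_map !(tlift_tens (form_map_balanced _ _ _)).
  by rewrite orth_isometry.
rewrite /orth_act /tmap (tliftD bg) /form_map !(tliftD (form_map_balanced _ _ _)).
by congr (_ + _).
Qed.

Lemma form_im_orth_act x g : form_im b (orth_act x g) = form_im b x.
Proof.
apply/submodule_eqP => u; have [h gK hK] := orth_bij g.
apply/asboolP/asboolP => -[v <-].
  by exists (h v); rewrite -(form_map_orth_act x g) hK.
by exists (g v); rewrite form_map_orth_act.
Qed.

Lemma quad_tensor_orth_act x g : quad_tensor b (orth_act x g) = quad_tensor b x.
Proof.
apply: val_inj; rewrite [x]tensor_sum.
have -> : orth_act (\sum_(p <- repr x) p.1 *t p.2) g =
    \sum_(p <- [seq (p.1, g p.2) | p <- repr x]) p.1 *t p.2.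
  rewrite big_map /orth_act /tmap (tlift_sum (tmap_balanced idfun g)).
  by apply: eq_bigr => p _; rewrite -/(tmap _ _ _) tmap_tens.
have := quad_tensor_sum b [seq (p.1, g p.2) | p <- repr x].
have := quad_tensor_sum b (repr x); rewrite /= => -> ->.
rewrite big_map; apply: eq_bigr => p _; rewrite big_map; apply: eq_bigr => q _ /=.
by rewrite orth_isometry.
Qed.

End OrthogonalAction.

Section OrbitInvariants.
Variables (R : comNzRingType) (N L : lmodType R) (b : {symmetric L}).
Hypothesis dualb : has_dual_family b.
Implicit Types (x y : tensor N L) (S : submodule N).

(** Eliminates the transport along an equality of images: lifts to [S (x) L] are unique, so any lift
    of [x] computes [T x] in [S (x) S]. *)
Lemma T_tensor_cast x S (eqS : form_im b x = S) (z : tensor (subm S) L) :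
  tmap val idfun z = x ->
  ecast N' (subm (symtensors (subm N'))) eqS (T_tensor dualb x) = quad_tensor b z.
Proof.
case: S / eqS z => z zx; congr (quad_tensor b _).
by apply: (image_lift_uniq dualb); rewrite image_liftK zx.
Qed.

Lemma lift_surjective x S (z : tensor (subm S) L) :
  form_im b x = S -> tmap val idfun z = x ->
  forall u, exists v, form_map b z v = u.
Proof.
move=> eqS zx [u uS]; have : u \in form_im b x by rewrite eqS.
move=> /asboolP[v xv]; exists v; apply: val_inj.
by rewrite /= -xv -zx form_map_tmap_val.
Qed.

(** Passing to lifts over the common image reduces the converse implication to surjective maps, the
    hypothesis here. The direct implication holds because an isometry changes neither the image nor
    the quadratic tensor of a lift. *)
Lemma same_orbit_iff x y :
    (forall S (zx zy : tensor (subm S) L),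
       (forall u, exists v, form_map b zx v = u) ->
       (forall u, exists v, form_map b zy v = u) ->
       quad_tensor_val b zx = quad_tensor_val b zy -> same_orbit b zx zy) ->
  same_orbit b x y <->
  exists eq_im : form_im b x = form_im b y,
    ecast N' (subm (symtensors (subm N'))) eq_im (T_tensor dualb x) = T_tensor dualb y.
Proof.
move=> orbitP.
have lift_y : tmap val idfun (image_lift dualb y) = y := image_liftK dualb y.
have lift_x : form_im b x = form_im b y ->
    exists zx : tensor (subm (form_im b y)) L, tmap val idfun zx = x.
  by case: _ /; apply: image_lift_ex.
split=> [[g xg]|[eq_im eqT]].
  have eq_im : form_im b x = form_im b y by rewrite -xg form_im_orth_act.
  have [zx zxK] := lift_x eq_im.
  exists eq_im; rewrite (T_tensor_cast eq_im zxK) -(quad_tensor_orth_act zx g).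
  apply/esym/(T_tensor_cast (erefl _)).
  by rewrite -orth_act_tmap_val zxK.
have [zx zxK] := lift_x eq_im.
have [|||g zg] := orbitP _ zx (image_lift dualb y).
- exact: lift_surjective eq_im zxK.
- exact: lift_surjective (erefl _) lift_y.
- by have := congr1 val (etrans (esym (T_tensor_cast eq_im zxK)) eqT).
by exists g; rewrite -zxK orth_act_tmap_val zg.
Qed.

End OrbitInvariants.

(** * Application to snt-modules *)

Lemma subm_killed (R : comNzRingType) (N : lmodType R) (S : submodule N) (a : R) :
  (forall u : N, a *: u = 0) -> forall u : subm S, a *: u = 0.
Proof. by move=> a0 u; apply: val_inj; apply: a0. Qed.

Lemma snt_mod_killed (F : fieldType) (M : sntModule F) :
  exists k, forall u : snt_mod M, fps_Xn F k *: u = 0.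
Proof.
have [k tk0] := snt_nilpotent M; exists k => u.
apply: etrans (snt_actE (fps_Xn F k) u tk0) _.
by apply: big1 => i _; rewrite /fps_Xn ltn_eqF // scale0r.
Qed.

Theorem theorem5p4 (F : fieldExtType rat) (M : sntModule F)
    (Mm Mp : {vspace M})
    (stabm : snt_stable Mm) (stabp : snt_stable Mp)
    (lagm : lagrangian Mm) (lagp : lagrangian Mp)
    (sumM : (Mm + Mp)%VS = fullv) (capM : (Mm :&: Mp)%VS = 0%VS)
    (V : vectType F) (b : {symmetric V}) (nondeg_b : nondegenerate b)
    (x y : tensor (subvs_of Mm) V) :
  let x' := scalar_ext stabm x in
  let y' := scalar_ext stabm y in
  let dual_b := series_dual_family nondeg_b in
  same_orbit (series_form b) x' y' <->
  exists eq_im : form_im (series_form b) x' = form_im (series_form b) y',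
    ecast N (subm (symtensors (subm N))) eq_im (T_tensor dual_b x')
      = T_tensor dual_b y'.
Proof.
move=> x' y' dual_b; apply: same_orbit_iff => S zx zy.
have two_neq0 : (2%:R : F) != 0.
  by rewrite -(rmorph_nat (in_alg F)) fmorph_eq0.
have [k killM] := snt_mod_killed M.
apply: (same_orbit_of_quad_tensor two_neq0 nondeg_b (N := k)).
(* [S] is a submodule of [M_-], itself a submodule of [M], which [t ^ k] annihilates. *)
exact/subm_killed/subm_killed.
Qed.
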